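(* Let $\Lambda$ be an Artin algebra and let $e=e^2$ be an idempotent in $\Lambda$. Assume that $e\Lambda$ is a projective left $e\Lambda e$-module. Let $m,n,r,s$ denote nonnegative integers. Then the following statements hold. (1) Assume that $\Lambda/\Lambda e\Lambda$ is an $(m,r)$-Igusa--Todorov algebra and $e\Lambda e$ is an $(n,s)$-Igusa--Todorov algebra. If $\Lambda/\Lambda e\Lambda$ is a projective right $\Lambda$-module, then $\Lambda$ is a $(2m+n+2,\max\{r,s\})$-Igusa--Todorov algebra. (2) Assume that $\Lambda/\Lambda e\Lambda$ is an $(m,r)$-Igusa--Todorov algebra and $e\Lambda e$ is an $(n,s)$-Igusa--Todorov algebra. If $\Lambda/\Lambda e\Lambda$ is a projective left $\Lambda$-module and a projective right $\Lambda$-module, then $\Lambda$ is an $(m+n+1,\max\{r,s\})$-Igusa--Todorov algebra. (3) Assume that $\Lambda/\Lambda e\Lambda$ and $e\Lambda e$ are syzygy-finite algebras. If $\Lambda/\Lambda e\Lambda$ is a projective left $\Lambda$-module and a projective right $\Lambda$-module, then $\Lambda$ is an Igusa--Todorov algebra. (4) If $\mathsf{gl.dim}_{\Lambda/\Lambda e\Lambda}\Lambda<\infty$, then $$\mathrm{IT.dist}(e\Lambda e)\le\mathrm{IT.dist}(\Lambda)\le\mathrm{IT.dist}(e\Lambda e)+2.$$ Moreover, if in addition $\Lambda/\Lambda e\Lambda$ is a projective left $\Lambda$-module, then $$\mathrm{IT.dist}(e\Lambda e)\le\mathrm{IT.dist}(\Lambda)\le\mathrm{IT.dist}(e\Lambda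 e)+1.$$ (5) If $\Lambda/\Lambda e\Lambda$ is a projective right $\Lambda$-module, then $$\mathrm{IT.dist}(e\Lambda e)\le\mathrm{IT.dist}(\Lambda)\le 2\,\mathrm{IT.dist}(\Lambda/\Lambda e\Lambda)+\mathrm{IT.dist}(e\Lambda e)+2.$$ Moreover, if in addition $\Lambda/\Lambda e\Lambda$ is a projective left $\Lambda$-module, then $$\mathrm{IT.dist}(e\Lambda e)\le\mathrm{IT.dist}(\Lambda)\le \mathrm{IT.dist}(\Lambda/\Lambda e\Lambda)+\mathrm{IT.dist}(e\Lambda e)+1.$$
   Context: All modules are finitely generated; $\mathrm{mod}\text{-}\Lambda$ is the category of finitely generated right $\Lambda$-modules. For a module $V$, $\mathrm{add}(V)$ is the subcategory of direct summands of finite direct sums of copies of $V$. Syzygies: for $n\ge1$, $K$ is an $n$-syzygy of $X\in\mathrm{mod}\text{-}\Lambda$ if there is an exact sequence $0\to K\to P_{n-1}\to\cdots\to P_0\to X\to0$ with all $P_i$ projective in $\mathrm{mod}\text{-}\Lambda$; the $0$-syzygy of $X$ is $X$. $\Omega^n(\mathrm{mod}\text{-}\Lambda)$ is the subcategory of all $n$-syzygies. An Artin algebra $\Lambda$ is an $(m,n)$-Igusa--Todorov algebra ($m,n\ge0$) if there is $V\in\mathrm{mod}\text{-}\Lambda$ such that for every $N\in\Omega^n(\mathrm{mod}\text{-}\Lambda)$ there is an exact sequence $0\to V_m\to\cdots\to V_1\to V_0\to N\to0$ with all $V_i\in\mathrm{add}(V)$. The Igusa--Todorov distance $\mathrm{IT.dist}(\Lambda)$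 is the infimum of all $m\ge 0$ such that $\Lambda$ is an $(m,n)$-Igusa--Todorov algebra for some $n\ge0$. $\Lambda$ is an Igusa--Todorov algebra if it is a $(1,n)$-Igusa--Todorov algebra for some $n\ge 0$. $\Lambda$ is syzygy-finite if for some $n\ge0$ the subcategory $\Omega^n(\mathrm{mod}\text{-}\Lambda)$ is representation-finite (equivalently, $\Lambda$ is a $(0,n)$-Igusa--Todorov algebra for some $n\geq 0$). $\mathsf{gl.dim}_{\Lambda/\Lambda e\Lambda}\Lambda:=\sup\{\mathsf{pd}\,X_\Lambda\mid X\in\mathrm{mod}\text{-}\Lambda/\Lambda e\Lambda\}$, where $X$ is viewed as a right $\Lambda$-module via $\Lambda\to\Lambda/\Lambda e\Lambda$ and $\mathsf{pd}\,X_\Lambda$ is its projective dimension. *)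

(* Defs.v *)
From HB Require Import structures.
From mathcomp Require Import all_boot all_order all_algebra.
From mathcomp Require Import generic_quotient ring_quotient.
From mathcomp Require Import boolp classical_sets functions constructive_ereal ereal.

Set Implicit Arguments.
Unset Strict Implicit.
Unset Printing Implicit Defensive.

Import GRing.Theory.

Local Open Scope ring_scope.
Local Open Scope quotient_scope.
Local Open Scope classical_set_scope.

(* Rings are [pzRingType]s throughout: eLe is the zero ring when e = 0, and
   L/LeL is the zero ring when LeL = L.
   Left R-modules are objects of [lmodType R]; right R-modules are left modules
   over the converse ring R^c, so that [a *: x] stands for x.a. *)
Notation rmodType R := (lmodType R^c).

Section Modules.
Variable R : pzRingType.
Implicit Types M N P : lmodType R.

Definition fin_gen M :=
  exists (n : nat) (g : 'I_n -> M),
    forall x : M, exists c : 'I_n -> R, x = \sum_(i < n) c i *: g i.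

Definition surjective_map (T U : Type) (f : T -> U) := forall y, exists x, f x = y.

Definition isomorphic M N := exists f : {linear M -> N}, bijective f.

Definition zero_module M := forall x : M, x = 0.

Definition exact_at M N P (f : {linear M -> N}) (g : {linear N -> P}) :=
  range f = [set y | g y = 0].

Definition projective P :=
  forall (M N : lmodType R) (g : {linear M -> N}) (f : {linear P -> N}),
    surjective_map g -> exists h : {linear P -> M}, forall x, g (h x) = f x.

Definition direct_summand M N := exists W : lmodType R, isomorphic (M * W)%type N.

Definition in_add (V M : lmodType R) :=
  exists n : nat, direct_summand M {ffun 'I_n -> V}.

Definition indecomposable M :=
  ~ zero_module M /\
  forall M1 M2 : lmodType R,
    isomorphic M (M1 * M2)%type -> zero_module M1 \/ zero_module M2.

Definition submodule M (S : set M) :=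
  [/\ S 0, (forall x y, S x -> S y -> S (x + y))
     & forall (a : R) x, S x -> S (a *: x)].

Definition artinian M :=
  forall S : nat -> set M,
    (forall n, submodule (S n)) -> (forall n, S n.+1 `<=` S n) ->
    exists n, forall m, (n <= m)%N -> S m = S n.

End Modules.

Section Restriction.
Variables (R S : pzRingType) (f : {rmorphism R -> S}) (M : lmodType S).

Definition restriction_of (_ : {rmorphism R -> S}) : Type := M.
Local Notation restriction := (restriction_of f).
HB.instance Definition _ := GRing.Zmodule.on restriction.

Definition restriction_scale (a : R) (x : restriction) : restriction :=
  f a *: (x : M).

Fact restriction_scaleA a b x :
  restriction_scale a (restriction_scale b x) = restriction_scale (a * b) x.
Proof. by rewrite /restriction_scale scalerA rmorphM. Qed.

Fact restriction_scale1 : left_id 1 restriction_scale.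
Proof. by move=> x; rewrite /restriction_scale rmorph1 scale1r. Qed.

Fact restriction_scaleDr : right_distributive restriction_scale +%R.
Proof. by move=> a x y; rewrite /restriction_scale scalerDr. Qed.

Fact restriction_scaleDl x : {morph restriction_scale^~ x : a b / a + b}.
Proof. by move=> a b; rewrite /restriction_scale rmorphD scalerDl. Qed.

HB.instance Definition _ := GRing.Zmodule_isLmodule.Build R restriction
  restriction_scaleA restriction_scale1 restriction_scaleDr restriction_scaleDl.

End Restriction.

Notation restriction f M := (restriction_of M f).

Section ConverseMorphism.
Variables (R S : pzRingType) (f : {rmorphism R -> S}).

Definition converse_map : R^c -> S^c := f.

Fact converse_map_zmod : zmod_morphism converse_map.
Proof. exact: (rmorphB f). Qed.

Fact converse_map_monoid : monoid_morphism converse_map.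
Proof. by split=> [|x y]; [apply: (rmorph1 f) | apply: (rmorphM f)]. Qed.

HB.instance Definition _ :=
  GRing.isZmodMorphism.Build R^c S^c converse_map converse_map_zmod.
HB.instance Definition _ :=
  GRing.isMonoidMorphism.Build R^c S^c converse_map converse_map_monoid.

Definition converse_rmorphism : {rmorphism R^c -> S^c} := converse_map.

End ConverseMorphism.

Notation left_restriction f M := (restriction f M) (only parsing).
Notation right_restriction f M := (restriction (converse_rmorphism f) M) (only parsing).

Definition artinian_ring (k : comPzRingType) := artinian (k^o : lmodType k).

Definition artin_algebra (L : pzRingType) :=
  exists (k : comPzRingType) (phi : {rmorphism k -> L}),
    [/\ artinian_ring k,
        (forall c x, phi c * x = x * phi c)
      & fin_gen (left_restriction phi L^o : lmodType k)].

Record fgmod (L : pzRingType) := FGMod {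
  fgmod_sort :> rmodType L;
  fgmod_fin_gen : fin_gen fgmod_sort
}.

Section Homological.
Variable L : pzRingType.
Implicit Types (N : rmodType L) (X K V : fgmod L).

(* The exact sequence 0 -> C m -> ... -> C 1 -> C 0 -> N -> 0, the family C
   being continued by zero modules after position m. *)
Definition resolution (m : nat) (C : nat -> fgmod L) N :=
  exists (d : forall i, {linear C i.+1 -> C i}) (eps : {linear C 0 -> N}),
    [/\ (forall i, (m < i)%N -> zero_module (C i)),
        surjective_map eps,
        exact_at (d 0) eps
      & forall i, exact_at (d i.+1) (d i)].

(* For n = 0 this says K isomorphic to X. *)
Definition syzygy (n : nat) X K :=
  exists C : nat -> fgmod L,
    [/\ resolution n C X, (forall i, (i < n)%N -> projective (C i))
      & isomorphic (C n) K].

Definition Omega (n : nat) K := exists X, syzygy n X K.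

Definition IT_algebra (m n : nat) :=
  exists V, forall N : fgmod L, Omega n N ->
    exists C : nat -> fgmod L,
      resolution m C N /\ forall i, (i <= m)%N -> in_add V (C i).

(* Finitely many isomorphism classes of indecomposable modules occur as direct
   summands of the modules in the class; Omega n is closed under finite direct
   sums, but need not be closed under direct summands. *)
Definition representation_finite (C : fgmod L -> Prop) :=
  exists (n : nat) (Y : 'I_n -> fgmod L),
    forall X, indecomposable X ->
      (exists Z, C Z /\ direct_summand X Z) -> exists i, isomorphic X (Y i).

Definition proj_dim N : \bar rat :=
  ereal_inf [set x | exists2 n : nat,
    (exists C : nat -> fgmod L, resolution n C N /\ forall i, projective (C i))
    & x = n%:R%:E].

End Homological.

Arguments Omega {L} n K.
Arguments IT_algebra : clear implicits.

Definition IT_dist (L : pzRingType) : \bar rat :=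
  ereal_inf [set x | exists2 m : nat,
    (exists n : nat, IT_algebra L m n) & x = m%:R%:E].

Definition Igusa_Todorov_algebra (L : pzRingType) :=
  exists n : nat, IT_algebra L 1 n.

Definition syzygy_finite (L : pzRingType) :=
  exists n : nat, representation_finite (@Omega L n).

Section Corner.
Variables (L : pzRingType) (e : L) (idem_e : e * e = e).

(* eLe = {x | e x e = x}, with unit e. *)
Definition corner_pred : {pred L} := fun x => e * x * e == x.

Definition corner (_ : e * e = e) := {x : L | x \in corner_pred}.
Local Notation eLe := (corner idem_e).

HB.instance Definition _ := [isSub for (@sval L _ : eLe -> L)].
HB.instance Definition _ := [Choice of eLe by <:].

Fact corner_zmod_closed : zmod_closed corner_pred.
Proof.
split=> [|x y]; rewrite !unfold_in; first by rewrite mulr0 mul0r.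
by move=> /eqP ex /eqP ey; rewrite mulrBr mulrBl ex ey.
Qed.
HB.instance Definition _ := GRing.isZmodClosed.Build L corner_pred corner_zmod_closed.
HB.instance Definition _ := [SubChoice_isSubZmodule of eLe by <:].

Lemma corner_mulel (x : eLe) : e * val x = val x.
Proof. by have /eqP <- := valP x; rewrite !mulrA idem_e. Qed.

Lemma corner_muler (x : eLe) : val x * e = val x.
Proof. by have /eqP <- := valP x; rewrite -!mulrA idem_e. Qed.

Fact corner_one_subproof : e \in corner_pred.
Proof. by rewrite unfold_in !idem_e. Qed.
Definition corner_one : eLe := Sub e corner_one_subproof.

Fact corner_mul_subproof (x y : eLe) : val x * val y \in corner_pred.
Proof. by rewrite unfold_in mulrA corner_mulel -mulrA corner_muler. Qed.
Definition corner_mul (x y : eLe) : eLe := Sub (val x * val y) (corner_mul_subproof x y).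

Fact corner_mulA : associative corner_mul.
Proof. by move=> x y z; apply: val_inj; rewrite /= mulrA. Qed.
Fact corner_mul1 : left_id corner_one corner_mul.
Proof. by move=> x; apply: val_inj; rewrite /= corner_mulel. Qed.
Fact corner_mulr1 : right_id corner_one corner_mul.
Proof. by move=> x; apply: val_inj; rewrite /= corner_muler. Qed.
Fact corner_mulDl : left_distributive corner_mul +%R.
Proof. by move=> x y z; apply: val_inj; rewrite /= mulrDl. Qed.
Fact corner_mulDr : right_distributive corner_mul +%R.
Proof. by move=> x y z; apply: val_inj; rewrite /= mulrDr. Qed.

HB.instance Definition _ := GRing.Zmodule_isPzRing.Build eLe
  corner_mulA corner_mul1 corner_mulr1 corner_mulDl corner_mulDr.

(* eL = {x | e x = x}, a left eLe-module by multiplication in L. *)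
Definition eL_pred : {pred L} := fun x => e * x == x.

Definition eL_module (_ : e * e = e) := {x : L | x \in eL_pred}.
Local Notation eL := (eL_module idem_e).

HB.instance Definition _ := [isSub for (@sval L _ : eL -> L)].
HB.instance Definition _ := [Choice of eL by <:].

Fact eL_zmod_closed : zmod_closed eL_pred.
Proof.
split=> [|x y]; rewrite !unfold_in; first by rewrite mulr0.
by move=> /eqP ex /eqP ey; rewrite mulrBr ex ey.
Qed.
HB.instance Definition _ := GRing.isZmodClosed.Build L eL_pred eL_zmod_closed.
HB.instance Definition _ := [SubChoice_isSubZmodule of eL by <:].

Fact eL_scale_subproof (a : eLe) (x : eL) : val a * val x \in eL_pred.
Proof. by rewrite unfold_in mulrA corner_mulel. Qed.
Definition eL_scale (a : eLe) (x : eL) : eL := Sub (val a * val x) (eL_scale_subproof a x).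

Fact eL_scaleA a b x : eL_scale a (eL_scale b x) = eL_scale (a * b) x.
Proof. by apply: val_inj; rewrite /= mulrA. Qed.
Fact eL_scale1 : left_id 1 eL_scale.
Proof. by move=> x; apply: val_inj; apply/eqP/(valP x). Qed.
Fact eL_scaleDr : right_distributive eL_scale +%R.
Proof. by move=> a x y; apply: val_inj; rewrite /= mulrDr. Qed.
Fact eL_scaleDl x : {morph eL_scale^~ x : a b / a + b}.
Proof. by move=> a b; apply: val_inj; rewrite /= mulrDl. Qed.

HB.instance Definition _ := GRing.Zmodule_isLmodule.Build eLe eL
  eL_scaleA eL_scale1 eL_scaleDr eL_scaleDl.

End Corner.

Section IdealQuotient.
Variables (L : pzRingType) (e : L).

Definition LeL : {pred L} := fun x =>
  `[< exists (n : nat) (a b : 'I_n -> L), x = \sum_(i < n) a i * e * b i >].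

Lemma LeLP x : reflect
  (exists (n : nat) (a b : 'I_n -> L), x = \sum_(i < n) a i * e * b i) (x \in LeL).
Proof. exact: asboolP. Qed.

Lemma LeL_mull a x : x \in LeL -> a * x \in LeL.
Proof.
move=> /LeLP[n [u [v ->]]]; apply/LeLP; exists n, (fun i => a * u i), v.
by rewrite mulr_sumr; apply: eq_bigr => i _; rewrite !mulrA.
Qed.

Lemma LeL_mulr a x : x \in LeL -> x * a \in LeL.
Proof.
move=> /LeLP[n [u [v ->]]]; apply/LeLP; exists n, u, (fun i => v i * a).
by rewrite mulr_suml; apply: eq_bigr => i _; rewrite !mulrA.
Qed.

Fact LeL_zmod_closed : zmod_closed LeL.
Proof.
split=> [|x y].
  by apply/LeLP; exists 0, (fun=> 0), (fun=> 0); rewrite big_ord0.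
move=> /LeLP[n [u [v ->]]] /LeLP[m [u' [v' ->]]]; apply/LeLP.
exists (n + m)%N, (fun i => match fintype.split i with inl j => u j | inr j => - u' j end),
  (fun i => match fintype.split i with inl j => v j | inr j => v' j end).
rewrite big_split_ord /= -sumrN; congr (_ + _); apply: eq_bigr => i _.
  by rewrite (unsplitK (inl i)).
by rewrite (unsplitK (inr i)) !mulNr.
Qed.
HB.instance Definition _ := GRing.isZmodClosed.Build L LeL LeL_zmod_closed.

Definition quotient_ring : Type := {ideal_quot LeL}.
Local Notation Q := quotient_ring.
HB.instance Definition _ := GRing.Zmodule.on Q.

Definition quotient_proj (x : L) : Q := \pi_{ideal_quot LeL} x.

Lemma quotient_projP x y : quotient_proj x = quotient_proj y <-> x - y \in LeL.
Proof. by rewrite Quotient.idealrBE; split=> /eqP. Qed.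

Lemma quotient_proj_repr (x : Q) : quotient_proj (repr (x : {ideal_quot LeL})) = x.
Proof. exact: reprK. Qed.

Fact quotient_proj_zmod : zmod_morphism quotient_proj.
Proof.
by move=> x y; rewrite /quotient_proj (Quotient.pi_add LeL x (- y)) (Quotient.pi_opp LeL y).
Qed.
HB.instance Definition _ := GRing.isZmodMorphism.Build L Q quotient_proj quotient_proj_zmod.

Definition quotient_mul (x y : Q) : Q :=
  quotient_proj (repr (x : {ideal_quot LeL}) * repr (y : {ideal_quot LeL})).

Lemma quotient_projM x y :
  quotient_proj (x * y) = quotient_mul (quotient_proj x) (quotient_proj y).
Proof.
rewrite /quotient_mul; set x' := repr _; set y' := repr _.
have hx : x - x' \in LeL by apply/quotient_projP; rewrite quotient_proj_repr.
have hy : y - y' \in LeL by apply/quotient_projP; rewrite quotient_proj_repr.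
apply/quotient_projP.
have -> : x * y - x' * y' = (x - x') * y + x' * (y - y').
  by rewrite mulrBl mulrBr addrA subrK.
by apply: rpredD; [apply: LeL_mulr | apply: LeL_mull].
Qed.

Lemma quotient_ind (P : Q -> Prop) : (forall x, P (quotient_proj x)) -> forall x, P x.
Proof. by move=> h x; rewrite -(quotient_proj_repr x). Qed.

Fact quotient_mulA : associative quotient_mul.
Proof.
elim/quotient_ind=> x; elim/quotient_ind=> y; elim/quotient_ind=> z.
by rewrite -!quotient_projM mulrA.
Qed.
Fact quotient_mul1 : left_id (quotient_proj 1) quotient_mul.
Proof. by elim/quotient_ind=> x; rewrite -quotient_projM mul1r. Qed.
Fact quotient_mulr1 : right_id (quotient_proj 1) quotient_mul.
Proof. by elim/quotient_ind=> x; rewrite -quotient_projM mulr1. Qed.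
Fact quotient_mulDl : left_distributive quotient_mul +%R.
Proof.
elim/quotient_ind=> x; elim/quotient_ind=> y; elim/quotient_ind=> z.
by rewrite -raddfD -!quotient_projM mulrDl raddfD.
Qed.
Fact quotient_mulDr : right_distributive quotient_mul +%R.
Proof.
elim/quotient_ind=> x; elim/quotient_ind=> y; elim/quotient_ind=> z.
by rewrite -raddfD -!quotient_projM mulrDr raddfD.
Qed.

HB.instance Definition _ := GRing.Zmodule_isPzRing.Build Q
  quotient_mulA quotient_mul1 quotient_mulr1 quotient_mulDl quotient_mulDr.

Fact quotient_proj_monoid : monoid_morphism quotient_proj.
Proof. by split=> // x y; apply: quotient_projM. Qed.
HB.instance Definition _ := GRing.isMonoidMorphism.Build L Q quotient_proj quotient_proj_monoid.

Definition quotient_left : lmodType L := left_restriction quotient_proj Q^o.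

Definition quotient_right : rmodType L := right_restriction quotient_proj (Q^c)^o.

Definition relative_gl_dim : \bar rat :=
  ereal_sup [set x | exists X : fgmod Q,
    x = proj_dim (right_restriction quotient_proj X : rmodType L)].

End IdealQuotient.

(* Main.v *)
(* Let T = - (x)_{eLe} eL, which is exact and preserves finitely generated
   projectives because eL is projective over eLe, and let S X = Xe, so that
   S T = 1.  The counit T S X -> X has kernel K and cokernel C annihilated by e,
   hence K and C are L/LeL-modules; write I for its image.  Taking t-th syzygies
   of 0 -> K -> T S X -> I -> 0 and 0 -> I -> X -> C -> 0 by the horseshoe lemma
   bounds a resolution of the t-th syzygy of X by those of K, T S X and C.
   A t-th syzygy of T S X is obtained by applying T to one of S X; t-th
   syzygies of K and C are controlled by L/LeL when it is right projective, and
   can be chosen projective when the relative global dimension is at most t.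
   If L/LeL is left projective, then LeL has a right unit and K = 0.
   The lower bound follows by applying T, then S. *)

Require Import Defs.
From HB Require Import structures.
From mathcomp Require Import all_boot all_order all_algebra.
From mathcomp Require Import generic_quotient ring_quotient.
From mathcomp Require Import boolp classical_sets functions constructive_ereal ereal.
From mathcomp Require Import zify.

Set Implicit Arguments.
Unset Strict Implicit.
Unset Printing Implicit Defensive.

Import GRing.Theory.

Local Open Scope ring_scope.
Local Open Scope quotient_scope.
Local Open Scope classical_set_scope.

(** * Submodules and quotient modules *)

(** Every t-th syzygy of X must be resolved, while the horseshoe lemma builds only one. By Schanuel
    any two agree up to projective summands, so the regular module is adjoined to each resolving
    module. The subcategory add V is not closed under extensions. For 0 -> A -> E -> B -> 0 the add
    V-resolution of A is therefore paired with projective covers for B: its p terms V_i become V_i +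
    P_i, and a p-th syzygy of B remains, resolved by a module built from syzygies of the module
    resolving B. Hence numbers of terms add up. With m+1 terms for each of K and C and n+1 for T S X
    the total is 2m+n+3, that is length 2m+n+2; when K = 0 it is m+n+2, that is length m+n+1. The
    resolving module must not depend on X, so in the extension lemmas it is chosen before the
    modules of the sequence. Kernels must stay finitely generated, but an Artin algebra comes only
    with an artinian base ring. Its noetherianity is derived by filtering a module through products
    of maximal ideals of that ring. *)

Section LinearOf.
Variables (R : pzRingType) (M N : lmodType R) (f : M -> N).
Hypotheses (fD : {morph f : x y / x + y}) (fZ : forall a x, f (a *: x) = a *: f x).

Fact linear_of_subproof : linear f.
Proof. by move=> a x y; rewrite fD fZ. Qed.

Definition linear_of : {linear M -> N} :=
  HB.pack_for {linear M -> N} f (GRing.isLinear.Build R M N *:%R f linear_of_subproof).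

End LinearOf.

Section Submodules.
Variables (R : pzRingType) (M : lmodType R).

Section SubmoduleType.
Variables (S : set M) (subS : submodule S).

Definition submodule_pred (_ : submodule S) : {pred M} := fun x => `[< S x >].
Definition submodule_type := {x : M | x \in submodule_pred subS}.
Local Notation T := submodule_type.

HB.instance Definition _ := [isSub for (@sval M _ : T -> M)].
HB.instance Definition _ := [Choice of T by <:].

Lemma submodule_predE x : (x \in submodule_pred subS) = `[< S x >].
Proof. by []. Qed.

Fact submodule_zmod_closed : zmod_closed (submodule_pred subS).
Proof.
have [S0 SD SZ] := subS; split=> [|x y]; rewrite !submodule_predE.
  exact/asboolP.
move=> /asboolP Sx /asboolP Sy; apply/asboolP; apply: SD => //.
by rewrite -scaleN1r; apply: SZ.
Qed.
HB.instance Definition _ :=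
  GRing.isZmodClosed.Build M (submodule_pred subS) submodule_zmod_closed.
HB.instance Definition _ := [SubChoice_isSubZmodule of T by <:].

Fact submodule_scale_subproof (a : R) (x : T) : a *: val x \in submodule_pred subS.
Proof.
by have [_ _ SZ] := subS; apply/asboolP/SZ/asboolP; apply: (valP x).
Qed.
Definition submodule_scale a (x : T) : T := Sub (a *: val x) (submodule_scale_subproof a x).

Fact submodule_scaleA a b x :
  submodule_scale a (submodule_scale b x) = submodule_scale (a * b) x.
Proof. by apply: val_inj; rewrite /= scalerA. Qed.
Fact submodule_scale1 : left_id 1 submodule_scale.
Proof. by move=> x; apply: val_inj; rewrite /= scale1r. Qed.
Fact submodule_scaleDr : right_distributive submodule_scale +%R.
Proof. by move=> a x y; apply: val_inj; rewrite /= scalerDr. Qed.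
Fact submodule_scaleDl x : {morph submodule_scale^~ x : a b / a + b}.
Proof. by move=> a b; apply: val_inj; rewrite /= scalerDl. Qed.
HB.instance Definition _ := GRing.Zmodule_isLmodule.Build R T
  submodule_scaleA submodule_scale1 submodule_scaleDr submodule_scaleDl.

Definition submodule_val : {linear T -> M} :=
  @linear_of R T M val (fun _ _ => erefl) (fun _ _ => erefl).

Lemma submodule_val_inj : injective submodule_val.
Proof. exact: val_inj. Qed.

Lemma submodule_valP (x : T) : S (submodule_val x).
Proof. by apply/asboolP; apply: (valP x). Qed.

Lemma submodule_valK x : S x -> exists y, submodule_val y = x.
Proof. by move=> Sx; exists (Sub x (introT (asboolP _) Sx)). Qed.

Definition quotient_module : Type := {ideal_quot (submodule_pred subS)}.
Local Notation Q := quotient_module.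
HB.instance Definition _ := GRing.Zmodule.on Q.

Definition quotient_pi (x : M) : Q := \pi_{ideal_quot (submodule_pred subS)} x.

Lemma quotient_piP x y : quotient_pi x = quotient_pi y <-> S (x - y).
Proof.
split=> [/eqP|Sxy]; last apply/eqP.
  by rewrite -Quotient.idealrBE => /asboolP.
by rewrite -Quotient.idealrBE; apply/asboolP.
Qed.

Lemma quotient_piK (x : Q) : quotient_pi (repr (x : {ideal_quot (submodule_pred subS)})) = x.
Proof. exact: reprK. Qed.

Lemma quotient_piD x y : quotient_pi (x + y) = quotient_pi x + quotient_pi y.
Proof. by rewrite /quotient_pi (Quotient.pi_add (submodule_pred subS)). Qed.

Definition quotient_scale (a : R) (x : Q) : Q :=
  quotient_pi (a *: repr (x : {ideal_quot (submodule_pred subS)})).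

Lemma quotient_piZ a x : quotient_scale a (quotient_pi x) = quotient_pi (a *: x).
Proof.
apply/quotient_piP; rewrite -scalerBr; have [_ _] := subS; apply.
by apply/quotient_piP; rewrite quotient_piK.
Qed.

Lemma quotient_pi_ind (P : Q -> Prop) : (forall x, P (quotient_pi x)) -> forall x, P x.
Proof. by move=> h x; rewrite -(quotient_piK x). Qed.

Fact quotient_scaleA a b x : quotient_scale a (quotient_scale b x) = quotient_scale (a * b) x.
Proof. by elim/quotient_pi_ind: x => x; rewrite !quotient_piZ scalerA. Qed.
Fact quotient_scale1 : left_id 1 quotient_scale.
Proof. by elim/quotient_pi_ind=> x; rewrite quotient_piZ scale1r. Qed.
Fact quotient_scaleDr : right_distributive quotient_scale +%R.
Proof.
move=> a; elim/quotient_pi_ind=> x; elim/quotient_pi_ind=> y.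
by rewrite -quotient_piD !quotient_piZ scalerDr quotient_piD.
Qed.
Fact quotient_scaleDl x : {morph quotient_scale^~ x : a b / a + b}.
Proof.
by elim/quotient_pi_ind: x => x a b; rewrite !quotient_piZ scalerDl quotient_piD.
Qed.
HB.instance Definition _ := GRing.Zmodule_isLmodule.Build R Q
  quotient_scaleA quotient_scale1 quotient_scaleDr quotient_scaleDl.

Definition quotient_map : {linear M -> Q} :=
  @linear_of R M Q quotient_pi quotient_piD (fun a x => esym (quotient_piZ a x)).

Lemma quotient_map_surj : surjective_map quotient_map.
Proof. by move=> y; exists (repr (y : {ideal_quot (submodule_pred subS)})); apply: quotient_piK. Qed.

Lemma ker_quotient_map x : quotient_map x = 0 <-> S x.
Proof. by rewrite -(linear0 quotient_map) quotient_piP subr0. Qed.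

End SubmoduleType.

Lemma submodule_ker (N : lmodType R) (g : {linear M -> N}) : submodule [set x | g x = 0].
Proof.
split=> /= [|x y gx gy|a x gx]; first exact: linear0.
  by rewrite linearD gx gy addr0.
by rewrite linearZ /= gx scaler0.
Qed.

Lemma submodule_range (N : lmodType R) (g : {linear N -> M}) : submodule (range g).
Proof.
split=> [|_ _ [x _ <-] [y _ <-]|a _ [x _ <-]]; first by exists 0; rewrite ?linear0.
  by exists (x + y); rewrite ?linearD.
by exists (a *: x); rewrite ?linearZ.
Qed.

End Submodules.

(** * Short exact sequences *)

Section ShortExact.
Variable R : pzRingType.
Implicit Types A B C K M N P V W X Y : lmodType R.

Definition pair_map M N P (f : {linear P -> M}) (g : {linear P -> N}) :
  {linear P -> (M * N)%type}.
Proof.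
apply: (@linear_of R P (M * N)%type (fun x => (f x, g x))) => [x y|a x] /=.
  by rewrite !linearD.
by rewrite !linearZ.
Defined.

Definition copair_map M N P (f : {linear M -> P}) (g : {linear N -> P}) :
  {linear (M * N)%type -> P}.
Proof.
apply: (@linear_of R (M * N)%type P (fun x => f x.1 + g x.2)) => [x y|a x] /=.
  by rewrite !linearD addrACA.
by rewrite !linearZ scalerDr.
Defined.

Definition fst_map M N : {linear (M * N)%type -> M} :=
  @linear_of R (M * N)%type M fst (fun _ _ => erefl) (fun _ _ => erefl).
Definition snd_map M N : {linear (M * N)%type -> N} :=
  @linear_of R (M * N)%type N snd (fun _ _ => erefl) (fun _ _ => erefl).
Definition idmap M : {linear M -> M} :=
  @linear_of R M M id (fun _ _ => erefl) (fun _ _ => erefl).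

Definition zero_map M N : {linear M -> N}.
Proof.
by apply: (@linear_of R M N (fun=> 0)) => [x y|a x]; rewrite ?addr0 ?scaler0.
Defined.

Lemma linear_inverse M N (f : {linear M -> N}) :
  bijective f -> exists g : {linear N -> M}, cancel f g /\ cancel g f.
Proof.
move=> [g fK gK]; unshelve eexists (@linear_of R N M g _ _); last by split.
- by move=> x y; apply: (can_inj fK); rewrite linearD !gK.
- by move=> a x; apply: (can_inj fK); rewrite linearZ /= !gK.
Qed.

Lemma isomorphicP M N :
  isomorphic M N <->
  exists (f : {linear M -> N}) (g : {linear N -> M}), cancel f g /\ cancel g f.
Proof.
split=> [[f /linear_inverse[g fg]]|[f [g [fK gK]]]]; first by exists f, g.
by exists f; exists g.
Qed.

Lemma isomorphic_refl M : isomorphic M M.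
Proof. by exists (idmap M); exists id. Qed.

Lemma isomorphic_sym M N : isomorphic M N -> isomorphic N M.
Proof. by move=> /isomorphicP[f [g [fK gK]]]; exists g; exists f. Qed.

Lemma isomorphic_trans N M P : isomorphic M N -> isomorphic N P -> isomorphic M P.
Proof. by move=> [f bf] [g bg]; exists (g \o f); apply: bij_comp. Qed.

Lemma isomorphic_prod M M' N N' :
  isomorphic M M' -> isomorphic N N' -> isomorphic (M * N)%type (M' * N')%type.
Proof.
move=> /isomorphicP[f [f' [fK f'K]]] /isomorphicP[g [g' [gK g'K]]].
exists (pair_map (f \o fst_map M N) (g \o snd_map M N)).
exists (pair_map (f' \o fst_map M' N') (g' \o snd_map M' N')) => -[x y] /=.
  by rewrite fK gK.
by rewrite f'K g'K.
Qed.

Lemma isomorphic_prodC M N : isomorphic (M * N)%type (N * M)%type.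
Proof.
exists (pair_map (snd_map M N) (fst_map M N)).
by exists (pair_map (snd_map N M) (fst_map N M)) => -[].
Qed.

Lemma isomorphic_prodA M N P :
  isomorphic (M * (N * P))%type ((M * N) * P)%type.
Proof.
exists (pair_map (pair_map (fst_map M _) (fst_map N P \o snd_map M _))
                 (snd_map N P \o snd_map M _)).
by exists (pair_map (fst_map M N \o fst_map _ P)
  (pair_map (snd_map M N \o fst_map _ P) (snd_map _ P))) => [[x [y z]]|[[x y] z]].
Qed.

Lemma isomorphic_zero M N : isomorphic M N -> zero_module M -> zero_module N.
Proof. by move=> /isomorphicP[f [g [_ gK]]] M0 y; rewrite -(gK y) (M0 (g y)) linear0. Qed.

Lemma isomorphic_zerol M N : zero_module M -> isomorphic (M * N)%type N.
Proof.
move=> M0; exists (snd_map M N).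
by exists (pair_map (zero_map N M) (idmap N)) => [[x y]|//] /=; rewrite -(M0 x).
Qed.

Definition ses A B C (f : {linear A -> B}) (g : {linear B -> C}) :=
  [/\ injective f, surjective_map g & forall y, g y = 0 <-> exists x, f x = y].

Definition short_exact A B C := exists f g, @ses A B C f g.

Lemma exact_atP A B C (f : {linear A -> B}) (g : {linear B -> C}) :
  exact_at f g <-> forall y, g y = 0 <-> exists x, f x = y.
Proof.
split=> [fg y|fg].
  have : [set z | g z = 0] y = range f y by rewrite fg.
  move=> /= ->; split=> [[x _ <-]|[x <-]]; by exists x.
apply/seteqP; split=> y /=; first by case=> x _ <-; apply/fg; exists x.
by move/fg=> [x <-]; exists x.
Qed.

Lemma linear_injP M N (f : {linear M -> N}) : (forall x, f x = 0 -> x = 0) -> injective f.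
Proof. by move=> f0 x y fxy; apply/subr0_eq/f0; rewrite linearB fxy subrr. Qed.

Lemma ses_comp0 A B C (f : {linear A -> B}) (g : {linear B -> C}) x :
  ses f g -> g (f x) = 0.
Proof. by case=> _ _ fg; apply/fg; exists x. Qed.

Lemma short_exact_ker M N (g : {linear M -> N}) :
  surjective_map g ->
  exists (K : lmodType R) (i : {linear K -> M}), ses i g.
Proof.
move=> sg; exists (submodule_type (submodule_ker g)), (submodule_val (submodule_ker g)).
split; [exact: submodule_val_inj|exact: sg|].
move=> y; split; first by move=> gy0; apply: submodule_valK.
by move=> [x <-]; apply: (submodule_valP x).
Qed.

Lemma short_exact_coker M N (f : {linear M -> N}) :
  injective f ->
  exists (C : lmodType R) (p : {linear N -> C}), ses f p.
Proof.
move=> fI; exists (quotient_module (submodule_range f)), (quotient_map (submodule_range f)).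
split; [exact: fI|exact: quotient_map_surj|].
by move=> y; rewrite ker_quotient_map; split=> [[x _ <-]|[x <-]]; exists x.
Qed.

Lemma lift_kernel A B C X (f : {linear A -> B}) (g : {linear B -> C}) (h : {linear X -> B}) :
  ses f g -> (forall x, g (h x) = 0) -> exists h' : {linear X -> A}, forall x, f (h' x) = h x.
Proof.
move=> [fI _ fg] gh0; have /choice[k kP] x : exists y, f y = h x by apply/fg.
unshelve eexists (@linear_of R X A k _ _); last exact: kP.
- by move=> x y; apply: fI; rewrite linearD !kP linearD.
- by move=> a x; apply: fI; rewrite linearZ /= !kP linearZ.
Qed.

Lemma short_exact_iso A B C A' B' C' :
  isomorphic A A' -> isomorphic B B' -> isomorphic C C' ->
  short_exact A B C -> short_exact A' B' C'.
Proof.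
move=> /isomorphicP[a [a' [aK a'K]]] /isomorphicP[b [b' [bK b'K]]].
move=> /isomorphicP[c [c' [cK c'K]]] [f [g [fI sg fg]]].
exists (b \o (f \o a')), (c \o (g \o b')); split=> /=.
- by move=> x y /= /(can_inj bK)/fI/(can_inj a'K).
- by move=> y; have [x gx] := sg (c' y); exists (b x); rewrite /= bK gx c'K.
- move=> y; split=> [cgy0|[x <-]] /=.
    have /fg[x fx] : g (b' y) = 0 by apply: (can_inj cK); rewrite linear0.
    by exists (a x); rewrite /= aK fx b'K.
  by rewrite bK (_ : g _ = 0) ?linear0 //; apply/fg; exists (a' x).
Qed.

Lemma short_exact_prod A B C A' B' C' :
  short_exact A B C -> short_exact A' B' C' ->
  short_exact (A * A')%type (B * B')%type (C * C')%type.
Proof.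
move=> [f [g [fI sg fg]]] [f' [g' [f'I sg' fg']]].
exists (pair_map (f \o fst_map A A') (f' \o snd_map A A')).
exists (pair_map (g \o fst_map B B') (g' \o snd_map B B')).
split=> /=.
- by move=> [x y] [x1 y1] /= [/fI-> /f'I->].
- by move=> [y y']; have [x <-] := sg y; have [x' <-] := sg' y'; exists (x, x').
- move=> [y y'] /=; split.
    by move=> [/fg[x <-] /fg'[x' <-]]; exists (x, x').
  by move=> [[x x'] [<- <-]]; congr (_, _); [apply/fg; exists x | apply/fg'; exists x'].
Qed.

Lemma short_exact_idl A (Z : lmodType R) : zero_module Z -> short_exact Z A A.
Proof.
move=> Z0; exists (zero_map Z A), (idmap A); split=> //=.
- by move=> x y _; rewrite (Z0 x) (Z0 y).
- by move=> y; exists y.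
- by move=> y; split=> [->|[_ <-]//]; exists 0.
Qed.

Lemma short_exact_zerol A B C : zero_module A -> short_exact A B C -> isomorphic B C.
Proof.
move=> A0 [f [g [fI sg fg]]]; have gI : injective g.
  by apply: linear_injP => x /fg[y <-]; rewrite (A0 y) linear0.
have /choice[h hK] := sg; exists g; exists h => // x; apply: gI; exact: hK.
Qed.

Lemma projective_iso M N : isomorphic M N -> projective M -> projective N.
Proof.
move=> /isomorphicP[u [v [uK vK]]] pM X Y g f sg.
have [h hP] := pM X Y g (f \o u) sg.
by exists (h \o v) => x /=; rewrite hP /= vK.
Qed.

Lemma projective_prod M N : projective M -> projective N -> projective (M * N)%type.
Proof.
move=> pM pN X Y g f sg.
have [h hP] := pM _ _ g (f \o pair_map (idmap M) (zero_map M N)) sg.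
have [k kP] := pN _ _ g (f \o pair_map (zero_map N M) (idmap N)) sg.
exists (copair_map h k) => -[x y] /=; rewrite linearD hP kP /= -linearD.
by congr (f (_, _)) => /=; rewrite ?addr0 ?add0r.
Qed.

Lemma projective_zero (Z : lmodType R) : zero_module Z -> projective Z.
Proof.
move=> Z0 M N g f _; exists (zero_map Z M) => x /=.
by rewrite (Z0 x) !linear0.
Qed.

Lemma ses_section A B C (f : {linear A -> B}) (g : {linear B -> C}) (h : {linear C -> B}) :
  ses f g -> cancel h g -> isomorphic B (A * C)%type.
Proof.
move=> sfg hP; have [fI sg fg] := sfg.
have [r rP] : exists r : {linear B -> A},
    forall x, f (r x) = copair_map (idmap B) (GRing.opp \o (h \o g)) (x, x).
  apply: (lift_kernel (h := copair_map (idmap B) (GRing.opp \o (h \o g)) \o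
    pair_map (idmap B) (idmap B)) sfg) => x /=.
  by rewrite linearB hP subrr.
apply: isomorphic_sym; exists (copair_map f h).
exists (pair_map r g) => [[a p]|b] /=.
  have gfh : g (f a + h p) = p by rewrite linearD (ses_comp0 _ sfg) hP add0r.
  rewrite gfh; congr (_, _); apply: fI; rewrite rP /= gfh; exact: addrK.
by rewrite rP /= subrK.
Qed.

Lemma short_exact_projective A B P :
  projective P -> short_exact A B P -> isomorphic B (A * P)%type.
Proof.
move=> pP [f [g sfg]]; have [fI sg fg] := sfg.
have [h hP] := pP _ _ g (idmap P) sg.
exact: ses_section sfg hP.
Qed.

(** Only the cover of the right end has to be projective, since only P -> B is lifted to E. The
    module V is arbitrary, which lets an add V-resolution of A be spliced with a projective
    resolution of B. The new kernel is that of V + P -> E, given by V -> A -> E and the lift h. *)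
Lemma horseshoe A E B A1 V B1 P :
  short_exact A E B -> short_exact A1 V A -> short_exact B1 P B -> projective P ->
  exists E' : lmodType R, short_exact A1 E' B1 /\ short_exact E' (V * P)%type E.
Proof.
move=> [f [g sfg]] [a [b sab]] [c [d scd]] pP.
have [fI sg fg] := sfg; have [aI sb ab] := sab; have [cI sd cd] := scd.
have [h hP] := pP _ _ g d sg.
pose m := copair_map (f \o b) h.
have sm : surjective_map m.
  move=> x; have [p dp] := sd (g x).
  have /fg[y fy] : g (x - h p) = 0 by rewrite linearB hP dp subrr.
  by have [v bv] := sb y; exists (v, p); rewrite /= bv fy subrK.
have [E' [u su]] := short_exact_ker sm; have [uI _ um] := su.
exists E'; split; last by exists u, m.
have [r rP] : exists r : {linear E' -> B1}, forall x, c (r x) = (u x).2.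
  apply: (lift_kernel (h := snd_map V P \o u) scd) => x /=.
  have := ses_comp0 x su; rewrite /m /= => /(congr1 g).
  by rewrite linearD (ses_comp0 _ sfg) add0r hP linear0.
have [l lP] : exists l : {linear A1 -> E'}, forall x, u (l x) = (a x, 0).
  apply: (lift_kernel (h := pair_map a (zero_map A1 P)) su) => x /=.
  by rewrite (ses_comp0 _ sab) !linear0 addr0.
exists l, r; split.
- by move=> x y /(congr1 u); rewrite !lP => -[/aI].
- move=> y; have /fg[z fz] : g (h (c y)) = 0 by rewrite hP (ses_comp0 _ scd).
  have [v bv] := sb z.
  have /um[x ux] : m (- v, c y) = 0 by rewrite /= !linearN /= bv fz addNr.
  by exists x; apply: cI; rewrite rP ux.
- move=> y; split=> [ry0|[x <-]]; last by apply: cI; rewrite rP lP linear0.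
  have y2 : (u y).2 = 0 by rewrite -rP ry0 linear0.
  have /ab[x ax] : b (u y).1 = 0.
    apply: fI; rewrite linear0; have := ses_comp0 y su.
    by rewrite /m /= y2 linear0 addr0.
  by exists x; apply: uI; rewrite lP ax -y2 -surjective_pairing.
Qed.

(** E is the kernel of V -> B -> Y. The map V -> B carries it onto the kernel A of B -> Y, with the
    kernel B1 of V -> B left over. *)
Lemma kernel_of_composite A B Y B1 V :
  short_exact A B Y -> short_exact B1 V B ->
  exists E : lmodType R, short_exact B1 E A /\ short_exact E V Y.
Proof.
move=> [f [g sfg]] [a [b sab]]; have [fI sg fg] := sfg; have [aI sb ab] := sab.
have sm : surjective_map (g \o b).
  by move=> y; have [x <-] := sg y; have [v <-] := sb x; exists v.
have [E [u su]] := short_exact_ker sm; have [uI _ um] := su.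
exists E; split; last by exists u, (g \o b).
have [r rP] : exists r : {linear E -> A}, forall x, f (r x) = b (u x).
  by apply: (lift_kernel (h := b \o u) sfg) => x; apply: (ses_comp0 x su).
have [l lP] : exists l : {linear B1 -> E}, forall x, u (l x) = a x.
  by apply: (lift_kernel su) => x /=; rewrite (ses_comp0 _ sab) linear0.
exists l, r; split.
- by move=> x y /(congr1 u); rewrite !lP => /aI.
- move=> y; have [v bv] := sb (f y).
  have /um[x ux] : (g \o b) v = 0 by rewrite /= bv (ses_comp0 _ sfg).
  by exists x; apply: fI; rewrite rP ux.
- move=> y; split=> [ry0|[x <-]]; last first.
    by apply: fI; rewrite rP lP (ses_comp0 _ sab) linear0.
  have /ab[x ax] : b (u y) = 0 by rewrite -rP ry0 linear0.
  by exists x; apply: uI; rewrite lP.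
Qed.

(** The pullback X of P and P' over M, realised as the kernel of g - g', maps onto both projectives
    with kernels K and K'; both sequences split. *)
Lemma schanuel K P K' P' M :
  short_exact K P M -> short_exact K' P' M -> projective P -> projective P' ->
  isomorphic (K * P')%type (K' * P)%type.
Proof.
move=> [i [g sg]] [i' [g' sg']] pP pP'.
pose m : {linear (P * P')%type -> M} := copair_map g (GRing.opp \o g').
have mE x : m x = g x.1 - g' x.2 by [].
have [iI gS ig] := sg; have [i'I g'S ig'] := sg'.
have mS : surjective_map m.
  by move=> y; have [x <-] := gS y; exists (x, 0); rewrite mE /= linear0 subr0.
have [X [u su]] := short_exact_ker mS; have [uI _ um] := su.
have ug x : g (u x).1 = g' (u x).2.
  by apply/eqP; rewrite -subr_eq0 -mE (ses_comp0 _ su).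
have sX' : short_exact K X P'.
  have [l lP] : exists l : {linear K -> X}, forall x, u (l x) = (i x, 0).
    apply: (lift_kernel (h := pair_map i (zero_map K P')) su) => x.
    by rewrite mE /= (ses_comp0 _ sg) linear0 subrr.
  exists l, (snd_map P P' \o u); split=> /=.
  - by move=> x y /(congr1 u); rewrite !lP => -[/iI].
  - move=> y; have [p gp] := gS (g' y).
    have /um[x ux] : m (p, y) = 0 by rewrite mE /= gp subrr.
    by exists x; rewrite /= ux.
  - move=> y; split=> [uy0|[x <-]]; last by rewrite lP.
    have /ig[x ix] : g (u y).1 = 0 by rewrite ug uy0 linear0.
    by exists x; apply: uI; rewrite lP ix -uy0 -surjective_pairing.
have sX : short_exact K' X P.
  have [l lP] : exists l : {linear K' -> X}, forall x, u (l x) = (0, i' x).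
    apply: (lift_kernel (h := pair_map (zero_map K' P) i') su) => x.
    by rewrite mE /= (ses_comp0 _ sg') linear0 subrr.
  exists l, (fst_map P P' \o u); split=> /=.
  - by move=> x y /(congr1 u); rewrite !lP => -[/i'I].
  - move=> y; have [p gp] := g'S (g y).
    have /um[x ux] : m (y, p) = 0 by rewrite mE /= gp subrr.
    by exists x; rewrite /= ux.
  - move=> y; split=> [uy0|[x <-]]; last by rewrite lP.
    have /ig'[x ix] : g' (u y).2 = 0 by rewrite -ug uy0 linear0.
    by exists x; apply: uI; rewrite lP ix -uy0 -surjective_pairing.
apply: isomorphic_trans (short_exact_projective pP sX).
exact/isomorphic_sym/(short_exact_projective pP').
Qed.

End ShortExact.

(** * Finite generation and direct summands *)

Section Generation.
Variable R : pzRingType.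
Implicit Types A B C K M N P V W X Y : lmodType R.

Lemma fin_gen_surj M N (f : {linear M -> N}) : surjective_map f -> fin_gen M -> fin_gen N.
Proof.
move=> sf [n [g gP]]; exists n, (f \o g) => y.
have [x <-] := sf y; have [c ->] := gP x; exists c.
by rewrite linear_sum; apply: eq_bigr => i _; rewrite linearZ.
Qed.

Lemma fin_gen_iso M N : isomorphic M N -> fin_gen M -> fin_gen N.
Proof.
by move=> [f [g _ gK]]; apply: (@fin_gen_surj _ _ f) => y; exists (g y).
Qed.

Lemma fin_gen_prod M N : fin_gen M -> fin_gen N -> fin_gen (M * N)%type.
Proof.
move=> [m [g gP]] [n [h hP]].
exists (m + n)%N, (fun i => match fintype.split i with inl j => (g j, 0) | inr j => (0, h j) end).
move=> [x y]; have [c ->] := gP x; have [d ->] := hP y.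
exists (fun i => match fintype.split i with inl j => c j | inr j => d j end).
rewrite big_split_ord /=.
under [X in _ = X + _]eq_bigr => i _ do rewrite (unsplitK (inl i)).
under [X in _ = _ + X]eq_bigr => i _ do rewrite (unsplitK (inr i)).
have fstE k (a : 'I_k -> R) (v : 'I_k -> (M * N)%type) :
    (\sum_(i < k) a i *: v i) = (\sum_(i < k) a i *: (v i).1, \sum_(i < k) a i *: (v i).2).
  by elim/big_rec3: _ => // i u1 u2 [z1 z2] _ [-> ->].
rewrite !fstE /=; congr (_, _) => /=.
  by rewrite [X in _ + X]big1 ?addr0 // => i _; rewrite scaler0.
by rewrite [X in X + _]big1 ?add0r // => i _; rewrite scaler0.
Qed.

Lemma fin_gen_zero M : zero_module M -> fin_gen M.
Proof. by move=> M0; exists 0, (fun=> 0) => x; exists (fun=> 0); rewrite big_ord0. Qed.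

Definition free_module n : lmodType R := {ffun 'I_n -> R^o}.

Definition basis_vector n (i : 'I_n) : free_module n := [ffun j => (i == j)%:R].

Lemma free_module_sum n (x : free_module n) : x = \sum_(i < n) (x i : R) *: basis_vector i.
Proof.
apply/ffunP => j; rewrite sum_ffunE (bigD1 j) //= big1 => [|i ij].
  by rewrite !ffunE eqxx addr0 /GRing.scale /= mulr1.
by rewrite !ffunE (negPf ij) /GRing.scale /= mulr0.
Qed.

Lemma fin_gen_free n : fin_gen (free_module n).
Proof.
by exists n, (@basis_vector n) => x; exists x; apply: free_module_sum.
Qed.

Definition combination_map M n (g : 'I_n -> M) : {linear free_module n -> M}.
Proof.
apply: (@linear_of R (free_module n) M (fun x => \sum_(i < n) (x i : R) *: g i)).
  by move=> x y; rewrite -big_split; apply: eq_bigr => i _; rewrite ffunE scalerDl.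
by move=> a x; rewrite scaler_sumr; apply: eq_bigr => i _; rewrite ffunE scalerA.
Defined.

Lemma projective_free n : projective (free_module n).
Proof.
move=> M N g f sg; have /choice[m mP] i := sg (f (basis_vector i)).
exists (combination_map m) => x.
rewrite [x in RHS]free_module_sum !linear_sum; apply: eq_bigr => i _.
by rewrite !linearZ /= mP.
Qed.

Definition fg_projective P := projective P /\ fin_gen P.

Lemma fg_projective_free n : fg_projective (free_module n).
Proof. by split; [apply: projective_free | apply: fin_gen_free]. Qed.

Lemma fg_projective_prod M N :
  fg_projective M -> fg_projective N -> fg_projective (M * N)%type.
Proof. by move=> [pM gM] [pN gN]; split; [apply: projective_prod | apply: fin_gen_prod]. Qed.

Lemma fg_projective_zero M : zero_module M -> fg_projective M.
Proof. by move=> M0; split; [apply: projective_zero | apply: fin_gen_zero]. Qed.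

Lemma fg_projective_iso M N : isomorphic M N -> fg_projective M -> fg_projective N.
Proof.
by move=> MN [pM gM]; split; [apply: projective_iso MN pM | apply: fin_gen_iso MN gM].
Qed.

Lemma zero_free : zero_module (free_module 0).
Proof. by move=> x; apply/ffunP => -[]. Qed.

Lemma free_cover M : fin_gen M ->
  exists (n : nat) (g : {linear free_module n -> M}), surjective_map g.
Proof.
move=> [n [g gP]]; exists n, (combination_map g) => y; have [c ->] := gP y.
by exists [ffun i => c i]; apply: eq_bigr => i _; rewrite ffunE.
Qed.

Lemma projective_cover M : fin_gen M ->
  exists K P, fg_projective P /\ short_exact K P M.
Proof.
move=> /free_cover[n [g /short_exact_ker[K [i ig]]]].
by exists K, (free_module n); split; [apply: fg_projective_free | exists i, g].
Qed.

Lemma short_exact_fin_gen K M N : short_exact K M N -> fin_gen M -> fin_gen N.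
Proof. by move=> [_ [g [_ sg _]]]; apply: fin_gen_surj sg. Qed.

End Generation.

(** * The subcategory add V through maps factoring through V *)

Section Add.
Variable R : pzRingType.
Implicit Types A B C K M N P V W X Y : lmodType R.

(** A finite sum of composites M -> V -> N amounts to one map through a power of V, but needs no
    power and no complement. Here h is a bare function, so that sums and composites need not be
    bundled as linear maps again. *)
Definition factors_through V M N (h : M -> N) :=
  exists s : seq ({linear M -> V} * {linear V -> N}),
    forall x, h x = \sum_(p <- s) p.2 (p.1 x).

Lemma factors_throughD V M N (f g : M -> N) :
  factors_through V f -> factors_through V g -> factors_through V (fun x => f x + g x).
Proof. by move=> [s sP] [t tP]; exists (s ++ t) => x; rewrite big_cat sP tP. Qed.

Lemma factors_through_sum V M N I (r : seq I) (f : I -> M -> N) :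
  (forall i, factors_through V (f i)) -> factors_through V (fun x => \sum_(i <- r) f i x).
Proof.
move=> fP; elim: r => [|i r IH]; first by exists [::] => x; rewrite !big_nil.
have [s sP] := factors_throughD (fP i) IH.
by exists s => x; rewrite big_cons sP.
Qed.

Lemma factors_through_comp V M N M' N' (h : M -> N)
    (f : {linear M' -> M}) (g : {linear N -> N'}) :
  factors_through V h -> factors_through V (fun x => g (h (f x))).
Proof.
move=> [s sP]; exists [seq (p.1 \o f : {linear _ -> _}, g \o p.2 : {linear _ -> _}) | p : {linear M -> V} * {linear V -> N} <- s].
by move=> x; rewrite big_map sP linear_sum.
Qed.

(** Membership in add V becomes an identity between maps, which any additive functor preserves. The
    coordinates of an embedding into V^n give the sum; conversely the summands assemble into maps M
    -> V^n -> M composing to the identity, and such a retraction splits. *)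
Lemma in_addP V M : in_add V M <-> factors_through V (@id M).
Proof.
split=> [[n [W /isomorphicP[f [g [fK gK]]]]]|[s sP]].
  pose ev i : {linear {ffun 'I_n -> V} -> V} :=
    @linear_of R _ V (fun v : {ffun 'I_n -> V} => v i)
      (fun x y => ffunE _ i) (fun a x => ffunE _ i).
  have injD i : {morph (fun v : V => [ffun j => if i == j then v else 0] : {ffun 'I_n -> V}) :
      x y / x + y}.
    by move=> x y; apply/ffunP => j; rewrite !ffunE; case: eqP; rewrite ?addr0.
  have injZ i a (v : V) : [ffun j => if i == j then a *: v else 0] =
      a *: ([ffun j => if i == j then v else 0] : {ffun 'I_n -> V}).
    by apply/ffunP => j; rewrite !ffunE; case: eqP; rewrite ?scaler0.
  exists [seq (ev i \o (f \o pair_map (idmap M) (zero_map M W)) : {linear _ -> _},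
      (fst_map M W \o (g \o linear_of (injD i) (injZ i))) : {linear _ -> _}) | i <- enum 'I_n].
  move=> x; rewrite big_map big_enum /=.
  pose u := f (x, 0); transitivity (g u).1; first by rewrite fK.
  transitivity ((g (\sum_(i in 'I_n) [ffun j => if i == j then u i else 0])).1).
    congr (g _).1; apply/ffunP => j; rewrite sum_ffunE (bigD1 j) //= big1.
      by rewrite ffunE eqxx addr0.
    by move=> i ij; rewrite ffunE (negPf ij).
  by rewrite linear_sum (big_morph fst (fun _ _ => erefl) erefl).
(* The pair [p0] only serves as the default value of [nth]. *)
pose n := size s; pose p0 : {linear M -> V} * {linear V -> M} := (zero_map M V, zero_map V M).
have iD : {morph (fun x => [ffun i : 'I_n => (nth p0 s i).1 x]) : x y / x + y}.
  by move=> x y; apply/ffunP => i; rewrite !ffunE linearD.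
have iZ a x : [ffun i : 'I_n => (nth p0 s i).1 (a *: x)] =
    a *: [ffun i : 'I_n => (nth p0 s i).1 x].
  by apply/ffunP => i; rewrite !ffunE linearZ.
pose u := linear_of iD iZ.
have pD : {morph (fun v : {ffun 'I_n -> V} => \sum_(i < n) (nth p0 s i).2 (v i)) :
    x y / x + y}.
  by move=> x y; rewrite -big_split; apply: eq_bigr => i _; rewrite ffunE linearD.
have pZ a (v : {ffun 'I_n -> V}) : \sum_(i < n) (nth p0 s i).2 ((a *: v) i) =
    a *: \sum_(i < n) (nth p0 s i).2 (v i).
  by rewrite scaler_sumr; apply: eq_bigr => i _; rewrite ffunE linearZ.
pose v := linear_of pD pZ.
have uK : cancel u v.
  move=> x; rewrite /= [RHS]sP (big_nth p0) big_mkord.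
  by apply: eq_bigr => i _; rewrite ffunE.
have [K [i si]] : exists (K : lmodType R) (i : {linear K -> _}), ses i v.
  by apply: short_exact_ker => x; exists (u x).
exists n, K; apply: isomorphic_trans (isomorphic_prodC _ _) _.
exact/isomorphic_sym/(ses_section si uK).
Qed.

Lemma in_add_refl V : in_add V V.
Proof. by apply/in_addP; exists [:: (idmap V, idmap V)] => x; rewrite big_seq1. Qed.

Lemma factors_through_trans V W M N (h : M -> N) :
  in_add W V -> factors_through V h -> factors_through W h.
Proof.
move=> /in_addP VW [s sP].
have [t tP] : factors_through W (fun x => \sum_(p <- s) p.2 (p.1 x)).
  by apply: factors_through_sum => p; apply: factors_through_comp VW.
by exists t => x; rewrite sP.
Qed.

Lemma in_add_trans V W M : in_add W V -> in_add V M -> in_add W M.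
Proof. by move=> VW /in_addP VM; apply/in_addP; apply: factors_through_trans VM. Qed.

Lemma in_add_retract V M N (f : {linear N -> M}) (g : {linear M -> N}) :
  cancel f g -> in_add V M -> in_add V N.
Proof.
move=> fK /in_addP/(factors_through_comp f g)[s sP].
by apply/in_addP; exists s => x; rewrite -sP fK.
Qed.

Lemma in_add_iso V M N : isomorphic M N -> in_add V M -> in_add V N.
Proof. by move=> /isomorphicP[f [g [_ gK]]]; apply: in_add_retract gK. Qed.

Lemma in_add_prod V M N : in_add V M -> in_add V N -> in_add V (M * N)%type.
Proof.
move=> /in_addP Mv /in_addP Nv; apply/in_addP.
have [s sP] := factors_throughD
  (factors_through_comp (fst_map M N) (pair_map (idmap M) (zero_map M N)) Mv)
  (factors_through_comp (snd_map M N) (pair_map (zero_map N M) (idmap N)) Nv).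
by exists s => x; rewrite -sP; case: x => x y; congr (_, _); rewrite /= ?addr0 ?add0r.
Qed.

Lemma in_add_fst M N : in_add (M * N)%type M.
Proof.
by apply: (@in_add_retract _ _ _ (pair_map (idmap M) (zero_map M N)) (fst_map M N) _
  (in_add_refl _)).
Qed.

Lemma in_add_snd M N : in_add (M * N)%type N.
Proof.
by apply: (@in_add_retract _ _ _ (pair_map (zero_map N M) (idmap N)) (snd_map M N) _
  (in_add_refl _)).
Qed.

Lemma in_add_zero V M : zero_module M -> in_add V M.
Proof. by move=> M0; apply/in_addP; exists [::] => x; rewrite big_nil; apply: M0. Qed.

Lemma in_add_fin_gen V M : fin_gen V -> in_add V M -> fin_gen M.
Proof.
move=> gV /in_addP[s sP].
have [P [G [gP GP]]] : exists (P : lmodType R) (G : {linear P -> M}),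
    fin_gen P /\ forall x, exists y, G y = \sum_(p <- s) p.2 (p.1 x).
  elim: s {sP} => [|p s [P [G [gP GP]]]].
    exists (free_module R 0), (zero_map _ M); split; first exact: fin_gen_free.
    by move=> x; exists 0; rewrite big_nil.
  exists (V * P)%type, (copair_map p.2 G); split; first exact: fin_gen_prod.
  by move=> x; have [y yP] := GP x; exists (p.1 x, y); rewrite big_cons /= yP.
by apply: (@fin_gen_surj _ P M G) gP => x; have [y yP] := GP x; exists y; rewrite yP -sP.
Qed.

Definition reg_module : lmodType R := R^o.

Lemma projective_in_add P : fg_projective P -> in_add reg_module P.
Proof.
move=> [pP /free_cover[n [g sg]]].
have [h hP] := pP _ _ g (idmap P) sg.
have [K [i si]] := short_exact_ker sg.
exists n, K; apply: isomorphic_trans (isomorphic_prodC _ _) _.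
exact/isomorphic_sym/(ses_section si hP).
Qed.

End Add.

(** * Syzygies and finite resolutions by a fixed module *)

Definition noetherian (R : pzRingType) :=
  forall (M K : lmodType R) (i : {linear K -> M}), injective i -> fin_gen M -> fin_gen K.

Section Resolutions.
Variable R : pzRingType.
Implicit Types A B C E I K M N P U V W X Y : lmodType R.
Local Notation reg := (reg_module R).

(** The index counts terms, not length: a resolution V_m, ..., V_0 has index m + 1, and index 0
    forces the module to vanish. With this convention indices add along extensions. *)
Fixpoint resolved V k M : Prop :=
  if k is k'.+1 then
    exists V0 K, [/\ in_add V V0, short_exact K V0 M & resolved V k' K]
  else zero_module M.

Lemma resolved_mono V W k M : in_add W V -> resolved V k M -> resolved W k M.
Proof.
move=> WV; elim: k M => // k IH M [V0 [K [addV0 sK rK]]].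
by exists V0, K; split=> //; [apply: in_add_trans addV0 | apply: IH].
Qed.

Lemma resolved_iso V k M N : isomorphic M N -> resolved V k M -> resolved V k N.
Proof.
case: k => [|k] MN /=; first exact: isomorphic_zero.
move=> [V0 [K [addV0 sK rK]]]; exists V0, K; split=> //.
by apply: short_exact_iso sK; rewrite // ; apply: isomorphic_refl.
Qed.

Lemma resolved_le V k l M : (k <= l)%N -> resolved V k M -> resolved V l M.
Proof.
elim: k l M => [|k IH] [|l] M // kl.
  move=> M0; elim: l.+1 => // j IHj; exists M, M; split=> //; first exact: in_add_zero.
  exact: short_exact_idl.
move=> [V0 [K [addV0 sK rK]]]; exists V0, K; split=> //; exact: IH.
Qed.

Lemma resolved_in_add V M : in_add V M -> resolved V 1 M.
Proof.
move=> VM; exists M, (free_module R 0); split=> //; last exact: zero_free.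
exact/short_exact_idl/zero_free.
Qed.

Definition stably_isomorphic M N :=
  exists P Q : lmodType R, [/\ fg_projective P, fg_projective Q & isomorphic (M * P)%type (N * Q)%type].

Lemma stably_isomorphic_iso M N : isomorphic M N -> stably_isomorphic M N.
Proof.
move=> MN; exists (free_module R 0), (free_module R 0).
by split; try exact: fg_projective_free; apply: isomorphic_prod => //; apply: isomorphic_refl.
Qed.

(** Adding P to the first term resolves M + P, hence N + Q, with the same kernel K. The part V1 of
    V0 + P lying over N is the kernel of a map onto the projective Q, so it is a summand and stays
    in add V. At least one term is required, because a stably zero module is projective but not
    necessarily zero. *)
Lemma resolved_stable V k M N :
  in_add V reg -> stably_isomorphic M N -> resolved V k.+1 M -> resolved V k.+1 N.
Proof.
move=> Vreg [P [Q [pP pQ MN]]] [V0 [K [addV0 sK rK]]].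
have {sK} [i [g sg]] : short_exact K (V0 * P)%type (N * Q)%type.
  apply: short_exact_iso (isomorphic_refl _) (isomorphic_refl _) MN _.
  have := short_exact_prod sK (short_exact_idl P (@zero_free R)).
  apply: short_exact_iso; try exact: isomorphic_refl.
  apply: isomorphic_trans (isomorphic_prodC _ _) _.
  exact/isomorphic_zerol/zero_free.
have sQ : surjective_map (snd_map N Q \o g).
  by case: sg => _ sg _ q; have [x gx] := sg (0, q); exists x; rewrite /= gx.
have [V1 [j sj]] := short_exact_ker sQ.
have V0V1 : isomorphic (V0 * P)%type (V1 * Q)%type.
  by apply: short_exact_projective; [case: pQ | exists j, (snd_map N Q \o g)].
exists V1, K; split=> //.
  have /(in_add_iso V0V1) : in_add V (V0 * P)%type.
    by apply: in_add_prod => //; apply: in_add_trans Vreg _; apply: projective_in_add.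
  by move=> h; apply: in_add_trans h (in_add_fst _ _).
have [iI sgs ig] := sg; have [jI _ jg] := sj.
have [l lP] : exists l : {linear K -> V1}, forall x, j (l x) = i x.
  by apply: (lift_kernel sj) => x /=; rewrite (ses_comp0 _ sg).
exists l, (fst_map N Q \o (g \o j)); split=> /=.
- by move=> x y /(congr1 j); rewrite !lP => /iI.
- move=> y; have [x gx] := sgs (y, 0).
  have /jg[z jz] : (snd_map N Q \o g) x = 0 by rewrite /= gx.
  by exists z; rewrite /= jz gx.
- move=> y; split=> [gy0|[x <-]]; last by rewrite lP (ses_comp0 _ sg).
  have /ig[x ix] : g (j y) = 0.
    by rewrite [LHS]surjective_pairing gy0 -[X in (0, X)]/((snd_map N Q \o g) (j y))
      (ses_comp0 _ sj).
  by exists x; apply: jI; rewrite lP.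
Qed.

Fixpoint syzygy_of t X M : Prop :=
  if t is t'.+1 then
    exists X1 P, [/\ fg_projective P, short_exact X1 P X & syzygy_of t' X1 M]
  else isomorphic X M.

Lemma syzygy_of_isol t X Y M : isomorphic X Y -> syzygy_of t X M -> syzygy_of t Y M.
Proof.
case: t => [|t] XY /=; first exact/isomorphic_trans/isomorphic_sym.
move=> [X1 [P [pP sX sy]]]; exists X1, P; split=> //.
by apply: short_exact_iso sX => //; apply: isomorphic_refl.
Qed.

(** Adding Q to the cover of M and Q' to that of M' leaves both kernels unchanged and makes the
    covered modules isomorphic, so Schanuel's lemma applies. *)
Lemma stably_isomorphic_kernel K P M K' P' M' :
  fg_projective P -> fg_projective P' ->
  short_exact K P M -> short_exact K' P' M' ->
  stably_isomorphic M M' -> stably_isomorphic K K'.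
Proof.
move=> pP pP' sK sK' [Q [Q' [pQ pQ' MM']]].
have zl A : isomorphic (A * free_module R 0)%type A.
  apply: isomorphic_trans (isomorphic_prodC _ _) _.
  exact/isomorphic_zerol/zero_free.
have {}sK : short_exact K (P * Q)%type (M' * Q')%type.
  apply: short_exact_iso (zl K) (isomorphic_refl _) MM' _.
  exact/short_exact_prod/short_exact_idl/zero_free.
have {}sK' : short_exact K' (P' * Q')%type (M' * Q')%type.
  apply: short_exact_iso (zl K') (isomorphic_refl _) (isomorphic_refl _) _.
  exact/short_exact_prod/short_exact_idl/zero_free.
exists (P' * Q')%type, (P * Q)%type; split; try exact: fg_projective_prod.
by apply: schanuel sK sK' _ _; [case: (fg_projective_prod pP pQ) |
  case: (fg_projective_prod pP' pQ')].
Qed.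

Lemma syzygy_of_stable t X M X' M' :
  stably_isomorphic X X' -> syzygy_of t X M -> syzygy_of t X' M' ->
  stably_isomorphic M M'.
Proof.
elim: t X X' => [|t IH] X X' XX' /=.
  move=> XM XM'; have [P [Q [pP pQ i]]] := XX'.
  exists P, Q; split=> //; apply: isomorphic_trans (isomorphic_prod XM' (isomorphic_refl Q)).
  by apply: isomorphic_trans i; apply: isomorphic_prod (isomorphic_refl P); apply: isomorphic_sym.
move=> [X1 [P [pP sX sy]]] [X1' [P' [pP' sX' sy']]].
apply: IH sy sy'; exact: stably_isomorphic_kernel pP pP' sX sX' XX'.
Qed.

(** The syzygies of the two ends may be prescribed; the one of the middle term is then dictated by
    the construction. Prescribing the middle one costs a stable isomorphism. *)
Lemma syzygy_of_horseshoe t A E B At Bt :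
  short_exact A E B -> syzygy_of t A At -> syzygy_of t B Bt ->
  exists Et, syzygy_of t E Et /\ short_exact At Et Bt.
Proof.
elim: t A E B => [|t IH] A E B sE /=.
  move=> AA BB; exists E; split; first exact: isomorphic_refl.
  by apply: short_exact_iso sE => //; apply: isomorphic_refl.
move=> [A1 [P [pP sA sy]]] [B1 [Q [pQ sB sy']]].
have [E1 [s1 s2]] := horseshoe sE sA sB (proj1 pQ).
have [Et [syE sEt]] := IH _ _ _ s1 sy sy'.
exists Et; split=> //; exists E1, (P * Q)%type; split=> //; exact: fg_projective_prod.
Qed.

Lemma syzygy_of_projective t P : fg_projective P -> exists M, syzygy_of t P M /\ fg_projective M.
Proof.
case: t => [|t] pP; first by exists P; split=> //; apply: isomorphic_refl.
have zP := fg_projective_free R 0.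
exists (free_module R 0); split=> //=; exists (free_module R 0), P; split=> //.
  exact/short_exact_idl/zero_free.
elim: t => [|t IH] /=; first exact: isomorphic_refl.
exists (free_module R 0), (free_module R 0); split=> //.
exact/short_exact_idl/zero_free.
Qed.

(** Taking kernels of covers respects add up to projectives. The identity of U0 is a sum of
    composites U0 -> U -> U0; lifting these to the covers P0 and F and restricting to kernels gives
    composites K0 -> U1 -> K0. Their sum differs from the identity of K0 by a map that factors
    through P0, which the summand [reg] absorbs. *)
Lemma kernel_in_add U U0 K0 P0 U1 F :
  in_add U U0 -> fg_projective P0 -> fg_projective F ->
  short_exact K0 P0 U0 -> short_exact U1 F U -> in_add (U1 * reg)%type K0.
Proof.
move=> /in_addP[s sP] pP0 pF [i [g sg]] [j [h sh]].
have [iI sgs ig] := sg; have [jI shs jh] := sh.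
have [s' s'P] : exists s' : seq ({linear P0 -> F} * {linear F -> P0}),
   (forall x, g x = g (\sum_(p <- s') p.2 (p.1 x))) /\
   (exists s1 : seq ({linear K0 -> U1} * {linear U1 -> K0}),
     forall x, \sum_(p <- s') p.2 (p.1 (i x)) = i (\sum_(p <- s1) p.2 (p.1 x))).
  suff [s' [s'P s1P]] : exists s' : seq ({linear P0 -> F} * {linear F -> P0}),
     (forall x, \sum_(p <- s) p.2 (p.1 (g x)) = g (\sum_(p <- s') p.2 (p.1 x))) /\
     (exists s1 : seq ({linear K0 -> U1} * {linear U1 -> K0}),
       forall x, \sum_(p <- s') p.2 (p.1 (i x)) = i (\sum_(p <- s1) p.2 (p.1 x))).
    by exists s'; split=> // x; rewrite [LHS]sP s'P.
  elim: s {sP} => [|[a b] s [s' [s'P [s1 s1P]]]].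
    by exists [::]; split=> [x|]; [|exists [::] => x]; rewrite !big_nil linear0.
  have [a' a'P] := proj1 pP0 _ _ h (a \o g) shs.
  have [b' b'P] := proj1 pF _ _ g (b \o h) sgs.
  have [a1 a1P] : exists a1 : {linear K0 -> U1}, forall x, j (a1 x) = a' (i x).
    apply: (lift_kernel (h := a' \o i) sh) => x /=.
    by rewrite a'P /= (ses_comp0 _ sg) linear0.
  have [b1 b1P] : exists b1 : {linear U1 -> K0}, forall x, i (b1 x) = b' (j x).
    apply: (lift_kernel (h := b' \o j) sg) => x /=.
    by rewrite b'P /= (ses_comp0 _ sh) linear0.
  exists ((a', b') :: s'); split=> [x|].
    by rewrite !big_cons linearD s'P /= b'P /= a'P.
  by exists ((a1, b1) :: s1) => x; rewrite !big_cons linearD s1P /= b1P a1P.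
have {s'P} [gP [s1 s1P]] := s'P.
(* The lifted sum covers the identity of U0, so its difference d from the identity of P0 lands in
   K0. Restricted to K0, it is the error term t \o i. *)
have [d dP] : exists d : {linear P0 -> P0}, forall x, d x = x - \sum_(p <- s') p.2 (p.1 x).
  unshelve eexists (@linear_of R P0 P0 (fun x => x - \sum_(p <- s') p.2 (p.1 x)) _ _) => //.
    move=> x y /=; under eq_bigr do rewrite !linearD.
    by rewrite big_split opprD addrACA.
  move=> a x /=; under eq_bigr do rewrite !linearZ.
  by rewrite -scaler_sumr scalerBr.
have [t tP] : exists t : {linear P0 -> K0}, forall x, i (t x) = d x.
  by apply: (lift_kernel sg) => x; rewrite dP linearB -gP subrr.
apply/in_addP.
have f1 : factors_through (U1 * reg)%type (fun x : K0 => \sum_(p <- s1) p.2 (p.1 x)).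
  by apply: factors_through_trans (in_add_fst _ _) _; exists s1.
have f2 : factors_through (U1 * reg)%type (fun x : K0 => t (i x)).
  have /in_addP P0P0 := in_add_trans (in_add_snd U1 reg) (projective_in_add pP0).
  exact: factors_through_comp i t P0P0.
have [s2 s2P] := factors_throughD f1 f2.
exists s2 => x; rewrite -s2P; apply: iI.
by rewrite linearD tP dP -s1P addrC subrK.
Qed.

Lemma fin_gen_reg : fin_gen reg.
Proof. by exists 1, (fun=> 1) => x; exists (fun=> x); rewrite big_ord1 /GRing.scale /= mulr1. Qed.

Hypothesis noethR : noetherian R.

Lemma syzygy_of_exists t X : fin_gen X -> exists M, syzygy_of t X M.
Proof.
elim: t X => [|t IH] X gX; first by exists X; apply: isomorphic_refl.
have [K [P [pP sK]]] := projective_cover gX.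
have [|M sM] := IH K; last by exists M, K, P.
by have [i [_ [iI _ _]]] := sK; apply: noethR iI (proj2 pP).
Qed.

Lemma syzygy_of_fin_gen t X M : fin_gen X -> syzygy_of t X M -> fin_gen M.
Proof.
elim: t X => [|t IH] X gX /=; first by move/fin_gen_iso; apply.
move=> [X1 [P [[_ gP] [i [g [iI _ _]]]]]]; apply: IH; exact: noethR iI gP.
Qed.

(** The same U1 serves all k and B: it is a syzygy of U plus the regular module. Passing to a syzygy
    of B replaces every term of its resolution by a syzygy of that term plus a projective, so the
    number of terms does not grow. *)
Lemma resolved_syzygy U : fin_gen U ->
  exists U1, fin_gen U1 /\ forall k B, resolved U k B ->
    exists B1 P, [/\ fg_projective P, short_exact B1 P B & resolved U1 k B1].
Proof.
move=> gU; have [K [F [pF sK]]] := projective_cover gU.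
have gK : fin_gen K by have [i [_ [iI _ _]]] := sK; apply: noethR iI (proj2 pF).
exists (K * reg)%type; split.
  apply: fin_gen_prod => //.
  exact: fin_gen_reg.
elim=> [|k IH] B.
  move=> B0; exists B, B; split=> //; first exact: fg_projective_zero.
  exact: short_exact_idl.
move=> [U0 [B' [addU0 sB rB']]].
have [K0 [P0 [pP0 sK0]]] := projective_cover (in_add_fin_gen gU addU0).
have [B'1 [P' [pP' sB' rB'1]]] := IH _ rB'.
(* B1 is an extension of B' by K0. The horseshoe lemma, with K0 covered by itself and B' by P', then
   yields a first term K0 + P' whose kernel is isomorphic to the syzygy B'1. *)
have [B1 [sB1 sB1']] := kernel_of_composite sB sK0.
have [E' [s1 s2]] := horseshoe sB1 (short_exact_idl K0 (@zero_free R)) sB' (proj1 pP').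
exists B1, P0; split=> //; exists (K0 * P')%type, E'; split=> //.
  apply: in_add_prod; first exact: kernel_in_add addU0 pP0 pF sK0 sK.
  exact: in_add_trans (in_add_snd _ _) (projective_in_add pP').
apply: resolved_iso rB'1; apply: isomorphic_sym; apply: short_exact_zerol s1.
exact: zero_free.
Qed.

(** Each term V0 of A is paired with a projective P covering the current syzygy of B. After p steps
    A is used up, and the p-th syzygy of B still has q terms. Thus U' depends only on p and U: it is
    an iterated syzygy of U with regular summands. *)
Lemma resolved_extension p U : fin_gen U ->
  exists U', fin_gen U' /\ forall V q A E B, resolved V p A -> resolved U q B ->
    short_exact A E B -> resolved (V * U')%type (p + q) E.
Proof.
elim: p U => [|p IH] U gU.
  exists U; split=> // V q A E B A0 rB sE.
  apply: resolved_iso (resolved_mono (in_add_snd V U) rB).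
  exact/isomorphic_sym/(short_exact_zerol A0 sE).
have [U1 [gU1 U1P]] := resolved_syzygy gU.
have [U' [gU' U'P]] := IH _ gU1.
exists (U' * reg)%type; split; first by apply: fin_gen_prod => //; apply: fin_gen_reg.
move=> V q A E B [V0 [A1 [addV0 sA rA1]]] /U1P[B1 [P [pP sB rB1]]] sE.
have [E' [s1 s2]] := horseshoe sE sA sB (proj1 pP).
exists (V0 * P)%type, E'; split=> //.
  apply: in_add_prod; first exact: in_add_trans (in_add_fst _ _) addV0.
  apply: in_add_trans (in_add_snd _ _) _.
  exact: in_add_trans (in_add_snd _ _) (projective_in_add pP).
apply: resolved_mono (U'P _ _ _ _ _ rA1 rB1 s1).
apply: in_add_prod (in_add_fst _ _) _.
exact: in_add_trans (in_add_snd _ _) (in_add_fst _ _).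
Qed.

(** The first term V0 of Y also maps onto I, and the kernel of V0 -> I is an extension of K by the
    kernel Y1 of V0 -> Y. This leaves p + q terms behind V0. *)
Lemma resolved_cokernel p U : fin_gen U ->
  exists U', fin_gen U' /\ forall V q K Y I, resolved U q K -> resolved V p.+1 Y ->
    short_exact K Y I -> resolved (V * U')%type (p + q).+1 I.
Proof.
move=> gU; have [U' [gU' U'P]] := resolved_extension p gU.
exists U'; split=> // V q K Y I rK [V0 [Y1 [addV0 sY rY1]]] sI.
have [E [s1 s2]] := kernel_of_composite sI sY.
exists V0, E; split=> //; first exact: in_add_trans (in_add_fst _ _) addV0.
exact: U'P rY1 rK s1.
Qed.

Definition resolved_syzygy_of U k t X :=
  exists Xt, syzygy_of t X Xt /\ resolved U k Xt.

(** [resolved_syzygy_of] provides one resolved syzygy, whereas the Igusa-Todorov condition concerns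
    all of them; adjoining the regular module bridges the gap. *)
Lemma resolved_syzygy_of_stable U k t X M :
  resolved_syzygy_of U k.+1 t X -> syzygy_of t X M -> resolved (U * reg)%type k.+1 M.
Proof.
move=> [M' [sM' /(resolved_mono (in_add_fst U reg)) rM']] sM.
apply: resolved_stable rM'; first exact: in_add_snd.
by apply: syzygy_of_stable sM' sM; apply/stably_isomorphic_iso/isomorphic_refl.
Qed.

Lemma resolved_syzygy_of_extension U V k l : fin_gen U -> fin_gen V ->
  exists W, fin_gen W /\ forall t A E B,
    short_exact A E B -> resolved_syzygy_of V k t A -> resolved_syzygy_of U l t B ->
    resolved_syzygy_of W (k + l) t E.
Proof.
move=> gU gV; have [U' [gU' U'P]] := resolved_extension k gU.
exists (V * U')%type; split; first exact: fin_gen_prod.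
move=> t A E B sE [At [sA rA]] [Bt [sB rB]].
have [Et [syE sEt]] := syzygy_of_horseshoe sE sA sB.
by exists Et; split=> //; apply: U'P rA rB sEt.
Qed.

Lemma resolved_syzygy_of_cokernel U V k l : fin_gen U -> fin_gen V ->
  exists W, fin_gen W /\ forall t K Y I, fin_gen Y ->
    short_exact K Y I -> resolved_syzygy_of U l t K -> resolved_syzygy_of V k.+1 t Y ->
    resolved_syzygy_of W (k + l).+1 t I.
Proof.
move=> gU gV; have [U' [gU' U'P]] := resolved_cokernel k gU.
exists (V * reg * U')%type; split.
  by do 2![apply: fin_gen_prod => //]; apply: fin_gen_reg.
move=> t K Y I gY sI [Kt [sK rK]] rY.
have [It syI] := syzygy_of_exists t (short_exact_fin_gen sI gY).
have [Yt [syY sYt]] := syzygy_of_horseshoe sI sK syI.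
exists It; split=> //; apply: U'P rK _ sYt.
(* The syzygy Yt comes from the horseshoe and need not be the one that [rY] resolves. *)
exact: resolved_syzygy_of_stable rY syY.
Qed.

End Resolutions.

(** * Artinian modules *)

Section Span.
Variables (R : pzRingType) (M : lmodType R).
Implicit Types (G S N : set M) (x y : M).

(** As an intersection of submodules it also covers infinite G, and membership is proved by choosing
    a suitable test submodule instead of handling coefficients. *)
Definition lspan G : set M :=
  [set x | forall S, submodule S -> G `<=` S -> S x].

Lemma lspan_submodule G : submodule (lspan G).
Proof.
split=> [S [S0 _ _]|x y Gx Gy S subS GS|a x Gx S subS GS] //.
  by have [_ SD _] := subS; apply: SD; [apply: Gx | apply: Gy].
by have [_ _ SZ] := subS; apply: SZ; apply: Gx.
Qed.

Lemma lspan_gen G : G `<=` lspan G.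
Proof. by move=> x Gx S _ GS; apply: GS. Qed.

Lemma lspan_least G S : submodule S -> G `<=` S -> lspan G `<=` S.
Proof. by move=> subS GS x Gx; apply: Gx. Qed.

Lemma lspanS G S : G `<=` S -> lspan G `<=` lspan S.
Proof.
by move=> GS; apply: lspan_least (lspan_submodule S) _ => x /GS; apply: lspan_gen.
Qed.

Lemma lspan_idem G S : G `<=` lspan S -> lspan G `<=` lspan S.
Proof. by move=> GS; apply: lspan_least (lspan_submodule S) GS. Qed.

Lemma submoduleB S x y : submodule S -> S x -> S y -> S (x - y).
Proof.
move=> [S0 SD SZ] Sx Sy; apply: SD => //.
by rewrite -scaleN1r; apply: SZ.
Qed.

Lemma lspan_adjoin G y x :
  lspan (G `|` [set y]) x -> exists w a, lspan G w /\ x = w + a *: y.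
Proof.
have [G0 GD GZ] := lspan_submodule G.
apply: (lspan_least (S := [set x | exists w a, lspan G w /\ x = w + a *: y])).
  split=> /=.
  - by exists 0, 0; rewrite scale0r addr0.
  - move=> _ _ [w [a [Gw ->]]] [w' [a' [Gw' ->]]].
    by exists (w + w'), (a + a'); rewrite scalerDl addrACA; split=> //; apply: GD.
  - move=> b _ [w [a [Gw ->]]]; exists (b *: w), (b * a).
    by rewrite scalerDr scalerA; split=> //; apply: GZ.
move=> z [Gz|->] /=; first by exists z, 0; rewrite scale0r addr0; split=> //; apply: lspan_gen.
by exists 0, 1; rewrite scale1r add0r.
Qed.

Lemma fin_genP : fin_gen M <-> exists s : seq M, forall x, lspan [set` s] x.
Proof.
split=> [[n [g gP]]|[s sP]].
  exists (codom g) => x S [S0 SD SZ] sS; have [c ->] := gP x.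
  elim/big_ind: _ => // i _; apply/SZ/sS => /=; exact: codom_f.
exists (size s), (fun i => s`_i) => x.
apply: (lspan_least (S := [set x | exists c : 'I_(size s) -> R, x = \sum_i c i *: s`_i])) (sP x).
  split=> /=.
  - by exists (fun=> 0); rewrite big1 // => i _; rewrite scale0r.
  - move=> _ _ [c ->] [d ->]; exists (fun i => c i + d i).
    by rewrite -big_split; apply: eq_bigr => i _; rewrite scalerDl.
  - move=> a _ [c ->]; exists (fun i => a * c i).
    by rewrite scaler_sumr; apply: eq_bigr => i _; rewrite scalerA.
move=> y /= ys; have ltys : (index y s < size s)%N by rewrite index_mem.
exists (fun i => (i == Ordinal ltys)%:R); rewrite (bigD1 (Ordinal ltys)) //=.
rewrite eqxx scale1r nth_index // big1 ?addr0 // => i ii.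
by rewrite (negPf ii) scale0r.
Qed.

Lemma artinian_minimal (F : set M -> Prop) :
  artinian M -> (forall S, F S -> submodule S) -> (exists S, F S) ->
  exists S, F S /\ forall S', F S' -> S' `<=` S -> S' = S.
Proof.
move=> artM Fsub [S0 FS0]; apply: contrapT => /forallNP noMin.
have step (S : {S | F S}) : exists S' : {S | F S}, sval S' `<=` sval S /\ sval S' <> sval S.
  have [S' ] : exists S', F S' /\ (S' `<=` sval S /\ S' <> sval S).
    apply: contrapT => /forallNP noS'; apply: (noMin (sval S)); split; first exact: (svalP S).
    move=> S' FS' S'S; apply: contrapT => neq; exact: noS' S' (conj FS' (conj S'S neq)).
  by move=> [FS' S'S]; exists (exist _ S' FS').
have [f fP] := choice step.
pose u n := iter n f (exist _ S0 FS0).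
have [n nP] := artM (fun n => sval (u n)) (fun n => Fsub _ (svalP (u n))) (fun n => (fP (u n)).1).
exact: (fP (u n)).2 (nP n.+1 (leqnSn n)).
Qed.

Definition fin_gen_set N := exists s : seq M, [set` s] `<=` N /\ N `<=` lspan [set` s].

End Span.

Section ArtinianModules.
Variables (R : pzRingType) (M : lmodType R).

Lemma submoduleI (S T : set M) : submodule S -> submodule T -> submodule (S `&` T).
Proof.
move=> [S0 SD SZ] [T0 TD TZ]; split=> // [x y [Sx Tx] [Sy Ty]|a x [Sx Tx]]; split.
- exact: SD.
- exact: TD.
- exact: SZ.
- exact: TZ.
Qed.

Lemma chain_subset (T : Type) (S : nat -> set T) :
  (forall n, S n.+1 `<=` S n) -> forall m n, (m <= n)%N -> S n `<=` S m.
Proof.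
move=> dS m n /subnK <-; elim: (n - m)%N => // j IH.
by rewrite addSn; apply: subset_trans (dS _) IH.
Qed.

(** Induction on the generators. For a new generator g, two chains stabilise: the intersections of S
    n with the span of the old generators, and the left ideals of coefficients of g occurring in S
    n. Together they determine S n within its chain. *)
Lemma artinian_fin_gen : artinian (R^o : lmodType R) -> fin_gen M -> artinian M.
Proof.
move=> artR /fin_genP[s sP].
suff H : forall S : nat -> set M, (forall n, submodule (S n)) ->
    (forall n, S n.+1 `<=` S n) -> (forall n, S n `<=` lspan [set` s]) ->
    exists n, forall m, (n <= m)%N -> S m = S n.
  by move=> S subS dS; apply: H => // n x _; apply: sP.
elim: s {sP} => [|g s IH] S subS dS Ss.
  exists 0%N => m _.
  have S0 n : S n = [set 0].
    apply/seteqP; split=> [x /Ss|_ ->]; last by case: (subS n).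
    apply: (lspan_least (S := [set 0])) => [|y //].
    by split=> //= [x1 y -> ->|a y ->]; rewrite ?addr0 ?scaler0.
  by rewrite !S0.
have subG := lspan_submodule [set` s]; have [G0 GD GZ] := subG.
have [n1 n1P] : exists n, forall m, (n <= m)%N ->
    S m `&` lspan [set` s] = S n `&` lspan [set` s].
  apply: (IH (fun n => S n `&` lspan [set` s])) => n.
  - exact: submoduleI.
  - by move=> x [Sx Gx]; split=> //; apply: dS.
  - exact: subIsetr.
have [n2 n2P] := artR (fun n => [set a : R | exists w, lspan [set` s] w /\ S n (w + a *: g)])
  (fun n => ltac:(
    have [Sn0 SnD SnZ] := subS n; split=> /=;
    [ exists 0; rewrite scale0r addr0; split=> //
    | by move=> a b [w [Gw Sw]] [w' [Gw' Sw']]; exists (w + w'); split; [apply: GD |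
        rewrite scalerDl addrACA; apply: SnD]
    | by move=> b a [w [Gw Sw]]; exists (b *: w); split; [apply: GZ |
        rewrite -scalerA -scalerDr; apply: SnZ]]))
  (fun n a => ltac:(by move=> [w [Gw Sw]]; exists w; split=> //; apply: dS)).
exists (maxn n1 n2) => m; rewrite geq_max => /andP[n1m n2m].
have nm : (maxn n1 n2 <= m)%N by rewrite geq_max n1m.
apply/seteqP; split; first exact: chain_subset dS _ _ nm.
move=> x Sx.
have [w [a [Gw xE]]] : exists w a, lspan [set` s] w /\ x = w + a *: g.
  apply: lspan_adjoin; apply: lspanS (Ss _ _ Sx) => y /=.
  by rewrite inE => /orP[/eqP->|ys]; [right | left].
(* The coefficient a of x already occurs in S m. Subtracting the element that realises it from x
   leaves w - w' in the old span, where the chain is constant as well. *)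
have [w' [Gw' Sw']] : exists w', lspan [set` s] w' /\ S m (w' + a *: g).
  rewrite -[exists w, _]/([set a : R | exists w, lspan [set` s] w /\ S m (w + a *: g)] a).
  rewrite n2P // /=; exists w; split=> //; rewrite -xE.
  exact: chain_subset dS _ _ (leq_maxr n1 n2) _ Sx.
have [_ SD _] := subS m.
have : (S m `&` lspan [set` s]) (w - w').
  rewrite n1P //; split; last exact: submoduleB subG Gw Gw'.
  apply: (chain_subset dS (leq_maxl n1 n2)).
  have -> : w - w' = x - (w' + a *: g) by rewrite xE opprD addrACA subrr addr0.
  apply: submoduleB => //; apply: (chain_subset dS nm) Sw'.
by move=> [Sww' _]; rewrite xE -[w](subrK w') -addrA; apply: SD.
Qed.

End ArtinianModules.

(** * Products of maximal ideals, and finite generation over a commutative artinian ring *)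

Section IdealProduct.
Variables (k : comPzRingType) (M : lmodType k).

Definition ideal_action (I : set k) (N : set M) : set M :=
  lspan [set x | exists a y, [/\ I a, N y & x = a *: y]].

Lemma ideal_action_submodule I N : submodule (ideal_action I N).
Proof. exact: lspan_submodule. Qed.

Lemma ideal_action_mem I N a y : I a -> N y -> ideal_action I N (a *: y).
Proof. by move=> Ia Ny; apply: lspan_gen; exists a, y. Qed.

Lemma ideal_action_least (I : set k) (N S : set M) : submodule S ->
  (forall a y, I a -> N y -> S (a *: y)) -> ideal_action I N `<=` S.
Proof. by move=> subS IS; apply: lspan_least => // _ [a [y [Ia Ny ->]]]; apply: IS. Qed.

Lemma ideal_action_sub I N : submodule N -> ideal_action I N `<=` N.
Proof. by move=> subN; apply: ideal_action_least => // a y _; case: subN => _ _; apply. Qed.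

Definition iterated_action (ms : seq (set k)) (N : set M) := foldr ideal_action N ms.

Lemma iterated_action_submodule ms N : submodule N -> submodule (iterated_action ms N).
Proof. by case: ms => [|m ms] //= _; apply: ideal_action_submodule. Qed.

End IdealProduct.

Section CommutativeArtinian.
Variable k : comPzRingType.
Local Notation kmod := (k^o : lmodType k).

(** Maximality is expressed as invertibility modulo m of every scalar outside m, that is, k/m is a
    field. This is how it gets used, to solve for a vector with coefficient outside m. *)
Definition maximal_ideal (m : set k) :=
  [/\ submodule (m : set kmod), ~ m 1 & forall a, ~ m a -> exists b, m (1 - b * a)].

(** Moving the product of ideals from N to k makes one vanishing product in k kill every module. *)
Lemma iterated_action_prod (M : lmodType k) (ms : seq (set k)) (N : set M) :
  iterated_action ms N `<=` ideal_action (iterated_action ms (setT : set kmod)) N.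
Proof.
elim: ms => [|m ms IH] /=; first by move=> x Nx; rewrite -[x]scale1r; apply: ideal_action_mem.
apply: ideal_action_least; first exact: ideal_action_submodule.
move=> a y ma /IH.
set S := [set z : M | ideal_action (ideal_action m (iterated_action ms (setT : set kmod))) N (a *: z)].
apply: (ideal_action_least (S := S)).
  have [S0 SD SZ] := ideal_action_submodule
    (ideal_action m (iterated_action ms (setT : set kmod))) N.
  split; rewrite /S /=; first by rewrite scaler0.
    by move=> u v Su Sv; rewrite scalerDr; apply: SD.
  by move=> b u Su; rewrite scalerA mulrC -scalerA; apply: SZ.
move=> b z Pb Nz; rewrite /S /= scalerA; apply: ideal_action_mem => //.
exact: (@ideal_action_mem k kmod m _ a b).
Qed.

(* A minimal product I of maximal ideals satisfies m I = I for every maximal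
   ideal m; were it nonzero, an ideal x k minimal with x I <> 0 would make the
   annihilator of x I a maximal ideal m with x I = x m I = 0. *)
Lemma maximal_product_zero : artinian_ring k ->
  exists ms : seq (set k),
    (forall i, (i < size ms)%N -> maximal_ideal (nth setT ms i)) /\
    iterated_action ms (setT : set kmod) `<=` [set 0].
Proof.
move=> artk.
pose max_seq ms := forall i, (i < size ms)%N -> maximal_ideal (nth setT ms i).
have subT : submodule (setT : set kmod) by [].
have [_ [[ms [msmax ->]] minI]] := @artinian_minimal k kmod
  (fun S => exists ms, max_seq ms /\ S = iterated_action ms (setT : set kmod)) artk
  ltac:(by move=> _ [ms [_ ->]]; apply: iterated_action_submodule)
  ltac:(by exists setT, [::]).
exists ms; split=> //; set I := iterated_action ms _ in minI *.
have subI : submodule I by apply: iterated_action_submodule.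
have mI (m : set k) : maximal_ideal m -> ideal_action m I = I.
  move=> mmax; apply: minI; last exact: ideal_action_sub.
  by exists (m :: ms); split=> // -[|i] //=; rewrite ltnS; apply: msmax.
move=> y0 Iy0 /=; apply: contrapT => y0N.
have [J [[subJ [x [y [Jx Iy xy]]]] minJ]] := @artinian_minimal k kmod
  (fun S => submodule S /\ exists x y, [/\ S x, I y & x * y <> 0]) artk
  ltac:(by move=> S []) ltac:(by exists setT; split=> //; exists 1, y0; rewrite mul1r).
pose m : set k := [set a | forall z, I z -> a * x * z = 0].
have subm : submodule (m : set kmod).
  split=> /= [z _|a b ma mb z Iz|a b mb z Iz]; first by rewrite !mul0r.
    by rewrite !mulrDl ma // mb // addr0.
  by rewrite /GRing.scale /= -!mulrA [x * z]mulrC mulrA -mulrA [z * x]mulrC mulrA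
    -[a * b * _]mulrA mulrA -!mulrA [b * _]mulrA mb // mulr0.
have mmax : maximal_ideal m.
  split=> //; first by move=> /(_ y Iy); rewrite mul1r.
  move=> a /existsNP[z /not_implyP[Iz axz]].
  have [J0 JD JZ] := subJ.
  have xkJ : [set c * (a * x) | c in setT] `<=` J.
    by move=> _ [c _ <-]; apply: (JZ c); apply: (JZ a).
  (* As a does not annihilate x I, the ideal generated by a x competes with J. By minimality it
     contains x = b a x, so that 1 - b a annihilates x I. *)
  have xkE : [set c * (a * x) | c in setT] = J.
    apply: minJ => //; split; last by exists (a * x), z; split=> //; exists 1; rewrite ?mul1r.
    split=> [|_ _ [c _ <-] [d _ <-]|c _ [d _ <-]].
    - by exists 0; rewrite ?mul0r.
    - by exists (c + d); rewrite ?mulrDl.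
    - by exists (c * d); rewrite -?mulrA.
  have [b _ bax] : [set c * (a * x) | c in setT] x by rewrite xkE.
  by exists b => w Iw; rewrite mulrBl mul1r -mulrA bax subrr mul0r.
have : ideal_action m I y by rewrite mI.
move=> Iy'; apply: xy; move: Iy'; apply: (ideal_action_least (S := [set y : kmod | x * y = 0])).
  split=> /= [|u v xu xv|a u xu]; first by rewrite mulr0.
    by rewrite mulrDr xu xv addr0.
  by rewrite /GRing.scale /= mulrCA xu mulr0.
by move=> a z ma Iz /=; rewrite /GRing.scale /= mulrA [x * a]mulrC ma.
Qed.

(** In effect N/mN is an artinian vector space over k/m, hence finite dimensional. The proof
    extracts from an infinitely generated N an independent sequence modulo mN, whose tails would
    form a strictly decreasing chain. *)
Lemma fin_gen_maximal_step (M : lmodType k) (m : set k) (N : set M) :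
  artinian M -> maximal_ideal m -> submodule N ->
  fin_gen_set (ideal_action m N) -> fin_gen_set N.
Proof.
move=> artM [subm m1 minv] subN [s' [s'N' N's']]; apply: contrapT => notfg.
have [N0 ND NZ] := subN.
set N' := ideal_action m N in s'N' N's'.
have N'N : N' `<=` N by apply: ideal_action_sub.
(* The function c returns a vector of N outside mN + <s>; the value 0 is a dummy for lists not
   contained in N. Iterating c gives x 0, x 1, ..., each outside the span of mN and its
   predecessors. *)
have /choice[c cP] (s : seq M) : exists x, [set` s] `<=` N ->
    N x /\ ~ lspan (N' `|` [set` s]) x.
  have [sN|sN] := pselect ([set` s] `<=` N); last by exists 0.
  apply: contrapT => /forallNP nox; apply: notfg.
  exists (s' ++ s); split=> [x /=|x Nx].
    by rewrite mem_cat => /orP[xs|xs]; [apply: N'N; apply: s'N' | apply: sN].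
  have : lspan (N' `|` [set` s]) x.
    by apply: contrapT => nx; apply: (nox x) => _.
  apply: lspan_idem => z [/N's'|zs].
    by apply: lspanS => u /= us; rewrite mem_cat us.
  by apply: lspan_gen; rewrite /= mem_cat zs orbT.
pose l n := iter n (fun s => c s :: s) [::]; pose x n := c (l n).
have lN n : [set` l n] `<=` N.
  elim: n => [|n IH] u //=; rewrite inE => /orP[/eqP->|]; last exact: IH.
  exact: (cP _ IH).1.
have xN n : ~ lspan (N' `|` [set` l n]) (x n) by apply: (cP _ (lN n)).2.
have xin n : N (x n) by apply: (cP _ (lN n)).1.
have lmono i j : (i < j)%N -> x i \in l j.
  elim: j => // j IH; rewrite ltnS leq_eqVlt => /orP[/eqP->|/IH h].
    by rewrite /= inE eqxx.
  by rewrite /= inE h orbT.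
(* Once the tails W stabilise at n, the vector x n is a combination modulo mN of later vectors x i.
   The sets A j record finitely many of these, so that [noj] can refute such a relation by induction
   on its length. *)
pose W n := lspan (N' `|` [set y | exists2 i, (n <= i)%N & y = x i]).
have [n nP] := artM W (fun n => lspan_submodule _) ltac:(move=> n; apply: lspanS => y [|[i ni ->]];
  [by left | right; exists i => //; exact: ltnW]).
have Wx : W n.+1 (x n) by rewrite nP //; apply: lspan_gen; right; exists n.
pose A j := N' `|` [set y | exists2 i, (n < i <= n + j)%N & y = x i].
have Amono i j : (i <= j)%N -> lspan (A i) `<=` lspan (A j).
  move=> ij; apply: lspanS => y [|[h /andP[nh hi] ->]]; [by left|right].
  by exists h => //; rewrite nh (leq_trans hi) // leq_add2l.
have noj j : ~ lspan (A j) (x n).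
  elim: j => [|j IH].
    move=> xA; apply: (xN n); apply: lspanS xA => y [|[i]]; first by left.
    by rewrite addn0 ltnNge; case: leqP.
  pose y := x (n + j).+1; have [B0 BD BZ] := lspan_submodule (A j).
  have ylj := lmono n (n + j).+1 (leq_addr _ _ : (n < (n + j).+1)%N).
  have Al : A j `<=` N' `|` [set` l (n + j).+1].
    by move=> z [|[i /andP[_ ij] ->]]; [left | right; apply: lmono].
  move=> xA; have /lspan_adjoin[w [a [Aw xE]]] : lspan (A j `|` [set y]) (x n).
    apply: lspanS xA => z [|[i /andP[ni]]]; first by left; left.
    rewrite addnS leq_eqVlt => /orP[/eqP-> ->|ij ->]; first by right.
    by left; right; exists i; rewrite // ni.
  (* If the last coefficient a is in m, its term is absorbed in mN and the relation gets shorter.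
     Otherwise a is invertible modulo m, and solving for the last vector contradicts its choice
     outside the span of mN and its predecessors. *)
  have [ma|/minv[b mb]] := pselect (m a).
    apply: IH; rewrite xE; apply: BD => //; apply: lspan_gen; left.
    by apply: ideal_action_mem => //; apply: xin.
  apply: (xN (n + j).+1); rewrite -/y.
  have [C0 CD CZ] := lspan_submodule (N' `|` [set` l (n + j).+1]).
  have -> : y = b *: (x n - w) + (1 - b * a) *: y.
    by rewrite xE addrAC subrr add0r scalerBl scale1r scalerA addrC subrK.
  apply: CD.
    apply: CZ; apply: (submoduleB (lspan_submodule _)); first by apply: lspan_gen; right.
    exact: lspanS Al _ Aw.
  by apply: lspan_gen; left; apply: ideal_action_mem => //; apply: xin.
suff [j /noj//] : exists j, lspan (A j) (x n).
apply: (lspan_least (S := [set z | exists j, lspan (A j) z])) Wx.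
  split=> /=; first by exists 0%N; have [] := lspan_submodule (A 0%N).
    move=> u v [i Au] [j Av]; exists (maxn i j).
    have [_ BD _] := lspan_submodule (A (maxn i j)).
    by apply: BD; [apply: Amono Au; apply: leq_maxl | apply: Amono Av; apply: leq_maxr].
  by move=> a u [i Au]; exists i; have [_ _ BZ] := lspan_submodule (A i); apply: BZ.
move=> z [N'z|[i ni ->]] /=; first by exists 0%N; apply: lspan_gen; left.
exists i; apply: lspan_gen; right; exists i => //.
by rewrite ni leq_addl.
Qed.

(** For a vanishing product of maximal ideals m_1 ... m_r, the chain N, m_r N, m_(r-1) m_r N, ...
    ends at 0. Finite generation climbs back from 0 to N, one maximal ideal at a time, which is why
    the induction removes the last ideal of the list. *)
Lemma artinian_module_fin_gen (M : lmodType k) : artinian_ring k -> artinian M ->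
  forall N : set M, submodule N -> fin_gen_set N.
Proof.
move=> /maximal_product_zero[ms [msmax ms0]] artM N subN.
have {ms0} : iterated_action ms N `<=` [set 0].
  apply: subset_trans (@iterated_action_prod M ms N) _; apply: ideal_action_least.
    by split=> //= [u v -> ->|a u ->]; rewrite ?addr0 ?scaler0.
  by move=> a y /ms0 -> _ /=; rewrite scale0r.
elim/last_ind: ms N subN msmax => [|ms m IH] N subN msmax /=.
  move=> N0; exists [::]; split=> // x /N0 ->.
  by have [] := lspan_submodule [set` [::] : seq M].
rewrite /iterated_action foldr_rcons => N0.
apply: (fin_gen_maximal_step (m := m)) => //.
  have := msmax (size ms); rewrite size_rcons nth_rcons ltnn eqxx; exact.
apply: IH => //; first exact: ideal_action_submodule.
move=> i ims; have := msmax i; rewrite size_rcons nth_rcons ims; apply.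
exact: ltnW.
Qed.

End CommutativeArtinian.

(** * Chain conditions for modules over a finite algebra over an artinian ring *)

Section ArtinAlgebras.
Variables (k : comPzRingType) (R : pzRingType) (phi : {rmorphism k -> R}).
Hypotheses (artk : artinian_ring k)
  (fgR : fin_gen (left_restriction phi R^o : lmodType k)).

Lemma submodule_restriction (M : lmodType R) (S : set M) :
  submodule S -> submodule (S : set (restriction phi M)).
Proof. by move=> [S0 SD SZ]; split=> // a x; apply: SZ. Qed.

Lemma fin_gen_restriction (M : lmodType R) :
  fin_gen M -> fin_gen (restriction phi M : lmodType k).
Proof.
move=> /fin_genP[ms msP]; have /fin_genP[rs rsP] := fgR.
apply/fin_genP; exists [seq (r : R) *: (x : M) | r <- rs, x <- ms] => x.
set G := [set` _]; have [S0 SD SZ] := lspan_submodule (G : set (restriction phi M)).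
have GM : lspan [set` ms] `<=` [set y : M | forall r : R, lspan (G : set (restriction phi M)) (r *: y)].
  apply: lspan_least.
    split=> /= [r|u v Gu Gv r|a u Gu r].
    - by rewrite scaler0.
    - by rewrite scalerDr; apply: SD.
    - by rewrite scalerA.
  move=> y yms r.
  have : lspan [set` rs] `<=`
      ([set r : R^o | lspan (G : set (restriction phi M)) ((r : R) *: (y : M))] :
         set (restriction phi R^o)).
    apply: lspan_least.
      split=> /= [|u v Gu Gv|a u Gu].
      - by rewrite scale0r.
      - by rewrite scalerDl; apply: SD.
      - by have := SZ a _ Gu; rewrite /GRing.scale /= /restriction_scale scalerA.
    by move=> r' /= rs'; apply: lspan_gen; apply: allpairs_f.
  by apply; apply: rsP.
by have := GM x (msP x) 1; rewrite scale1r.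
Qed.

Lemma artin_algebra_artinian (M : lmodType R) : fin_gen M -> artinian M.
Proof.
move=> /fin_gen_restriction/(artinian_fin_gen artk) artM S subS.
by apply: artM => n; apply: submodule_restriction.
Qed.

(** Over k the module M is finitely generated, hence artinian, so the image of K is finitely
    generated over k; preimages of its generators generate K over R. *)
Lemma artin_algebra_noetherian : noetherian R.
Proof.
move=> M K i iI /fin_gen_restriction gM.
have [s [si iS]] := artinian_module_fin_gen artk (artinian_fin_gen artk gM)
  (submodule_restriction (submodule_range i)).
have [t tP] : exists t, s = map i t.
  elim: s si {iS} => [|y s IH] si; first by exists [::].
  have [|t ->] := IH; first by move=> z zs; apply: si; rewrite /= inE zs orbT.
  by have [|x _ <-] := si y; [rewrite /= inE eqxx | exists (x :: t)].
apply/fin_genP; exists t => x.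
have [T0 TD TZ] := lspan_submodule [set` t].
suff [z [/iI <-]] : exists z, i z = i x /\ lspan [set` t] z by [].
have /iS : range i (i x) by exists x.
apply: (lspan_least (S := [set y : restriction phi M | exists z, i z = y /\ lspan [set` t] z])).
  split=> /=.
  - by exists 0; rewrite linear0.
  - by move=> _ _ [u [<- tu]] [v [<- tv]]; exists (u + v); rewrite linearD; split=> //; apply: TD.
  - by move=> a _ [u [<- tu]]; exists (phi a *: u); rewrite linearZ; split=> //; apply: TZ.
by move=> y; rewrite /= tP => /mapP[z zt ->]; exists z; split=> //; apply: lspan_gen.
Qed.

End ArtinAlgebras.

(** * Indexed resolutions versus iterated short exact sequences *)

Section Bridge.
Variable L : pzRingType.
Implicit Types (N K : rmodType L) (C : nat -> fgmod L).

Definition zero_fgmod : fgmod L := FGMod (fin_gen_free L^c 0).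

Lemma resolution0 C N : resolution 0 C N -> isomorphic (C 0%N) N.
Proof.
move=> [d [eps [C0 seps /exact_atP ex0 _]]].
have epsI : injective eps.
  by apply: linear_injP => x /ex0[y <-]; rewrite (C0 1%N isT y) linear0.
have /choice[g gP] := seps.
by exists eps; exists g => // x; apply: epsI; rewrite gP.
Qed.

Lemma resolution_tail m C N : resolution m.+1 C N ->
  exists K, short_exact K (C 0%N) N /\ resolution m (fun i => C i.+1) K.
Proof.
move=> [d [eps [C0 seps /exact_atP ex0 ex]]].
have [K [i si]] := short_exact_ker seps; have [iI _ ieps] := si.
exists K; split; first by exists i, eps.
have [r rP] : exists r : {linear C 1%N -> K}, forall x, i (r x) = d 0%N x.
  by apply: (lift_kernel si) => x; apply/ex0; exists x.
exists (fun j => d j.+1), r; split=> [j mj||| j]; last exact: ex.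
- exact: C0.
- move=> y; have /ex0[x dx] : eps (i y) = 0 by apply/ieps; exists y.
  by exists x; apply: iI; rewrite rP.
- apply/exact_atP => y; have /exact_atP e := ex 0%N; rewrite -e -rP.
  by split=> [->|iry]; [rewrite linear0 | apply: iI; rewrite iry linear0].
Qed.

Definition chain_cons (V : fgmod L) C i : fgmod L := if i is j.+1 then C j else V.

Lemma resolution_cons m (V : fgmod L) C N K :
  short_exact K V N -> resolution m C K -> resolution m.+1 (chain_cons V C) N.
Proof.
move=> [i [eps si]] [d [r [C0 sr /exact_atP ex0 ex]]].
have [iI seps ieps] := si.
exists (fun j => match j return {linear chain_cons V C j.+1 -> chain_cons V C j} with
   | 0 => i \o r | j'.+1 => d j' end), eps; split=> //.
- by case=> //= j; apply: C0.
- apply/exact_atP => y; rewrite ieps; split=> [[x <-]|[x <-]]; last by exists (r x).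
  by have [z <-] := sr x; exists z.
- case=> [|j]; last exact: ex.
  apply/exact_atP => y /=; rewrite -ex0; split=> [iry|->]; last by rewrite linear0.
  by apply: iI; rewrite iry linear0.
Qed.

Lemma resolution_single (V : fgmod L) N :
  isomorphic V N -> resolution 0 (chain_cons V (fun=> zero_fgmod)) N.
Proof.
move=> [f [g fK gK]].
exists (fun j => match j return {linear chain_cons V (fun=> zero_fgmod) j.+1 ->
    chain_cons V (fun=> zero_fgmod) j} with
   | 0 => zero_map _ _ | j'.+1 => zero_map _ _ end), f; split=> [[|j] //= _||| j].
- exact: zero_free.
- by move=> y; exists (g y).
- apply/exact_atP => y; split=> [fy|[x <-]] /=; last exact: linear0.
  by exists 0; apply: (can_inj fK); rewrite fy /= linear0.
- apply/exact_atP => y; split=> [_|_]; exists 0 || (case: j y => * //);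
  by rewrite [RHS]zero_free.
Qed.

Lemma resolution_resolved V m C N :
  resolution m C N -> (forall i, (i <= m)%N -> in_add V (C i)) -> resolved V m.+1 N.
Proof.
elim: m C N => [|m IH] C N.
  by move=> /resolution0 CN VC; apply: resolved_in_add; apply: in_add_iso CN (VC 0%N _).
move=> /resolution_tail[K [sK rK]] VC; exists (C 0%N), K; split=> //; first exact: VC.
by apply: IH rK _ => i im; apply: VC.
Qed.

Lemma resolved_resolution (V : rmodType L) m N : fin_gen V -> resolved V m.+1 N ->
  exists C, resolution m C N /\ forall i, (i <= m)%N -> in_add V (C i).
Proof.
move=> gV; elim: m N => [|m IH] N.
  move=> [V0 [K [addV0 sK K0]]].
  exists (chain_cons (FGMod (in_add_fin_gen gV addV0)) (fun=> zero_fgmod)); split.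
    exact/resolution_single/(short_exact_zerol K0 sK).
  by case.
move=> [V0 [K [addV0 sK /IH[C [rC VC]]]]].
exists (chain_cons (FGMod (in_add_fin_gen gV addV0)) C); split; first exact: resolution_cons rC.
by case=> //= i; apply: VC.
Qed.

Lemma syzygy_syzygy_of n (X K : fgmod L) : syzygy n X K -> syzygy_of n X K.
Proof.
move=> [C [rC pC CK]]; elim: n C (X : rmodType L) rC pC CK => [|n IH] C N rC pC CK /=.
  by apply: isomorphic_trans CK; apply/isomorphic_sym/resolution0.
have [X1 [sX1 rX1]] := resolution_tail rC.
exists X1, (C 0%N); split=> //; last first.
  by apply: IH rX1 _ CK => i ni; apply: pC.
by split; [apply: pC | apply: fgmod_fin_gen].
Qed.

Lemma syzygy_of_syzygy n (X K : fgmod L) : syzygy_of n X K -> syzygy n X K.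
Proof.
rewrite /syzygy; elim: n (X : rmodType L) => [|n IH] N /=.
  move=> NK; exists (chain_cons K (fun=> zero_fgmod)); split=> //.
    exact/resolution_single/isomorphic_sym.
  exact: isomorphic_refl.
move=> [X1 [P [[pP gP] sX /IH[C [rC pC CK]]]]].
exists (chain_cons (FGMod gP) C); split=> //; first exact: resolution_cons rC.
by case=> //= i; apply: pC.
Qed.

Lemma projective_resolution_syzygy n t C N : (n <= t)%N -> resolution n C N ->
  (forall i, projective (C i)) -> exists M, syzygy_of t N M /\ fg_projective M.
Proof.
move=> nt rC pC; have fpC i : fg_projective (C i).
  by split; [apply: pC | apply: fgmod_fin_gen].
elim: n t C N nt rC fpC {pC} => [|n IH] t C N.
  move=> _ /resolution0 CN fpC; exact: syzygy_of_projective (fg_projective_iso CN (fpC 0%N)).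
case: t => // t nt /resolution_tail[K [sK rK]] fpC.
have [M [sM pM]] := IH t _ K nt rK (fun i => fpC i.+1).
by exists M; split=> //; exists K, (C 0%N).
Qed.

(** The working form of the definition: modules need not be packaged with their finite generation,
    so kernels and images can be used directly, and length m appears as m + 1 terms. *)
Lemma IT_algebraP m n : IT_algebra L m n <->
  exists V : rmodType L, fin_gen V /\
    forall X M : rmodType L, fin_gen X -> fin_gen M -> syzygy_of n X M -> resolved V m.+1 M.
Proof.
split=> [[V VP]|[V [gV VP]]].
  exists V; split; first exact: fgmod_fin_gen.
  move=> X M gX gM sM.
  have /VP[C [rC VC]] : Omega n (FGMod gM).
    by exists (FGMod gX); apply: syzygy_of_syzygy.
  exact: resolution_resolved rC VC.
exists (FGMod gV) => N [X /syzygy_syzygy_of sN].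
apply: (resolved_resolution gV); apply: VP sN; exact: fgmod_fin_gen.
Qed.

(** A resolution may be padded with zeros, and an n'-th syzygy of X is an n-th syzygy of some (n' -
    n)-th syzygy of X, which is finitely generated because the ring is noetherian. *)
Lemma IT_algebra_leq m m' n n' : noetherian L^c -> (m <= m')%N -> (n <= n')%N ->
  IT_algebra L m n -> IT_algebra L m' n'.
Proof.
move=> noethL mm' /subnK <- /IT_algebraP[V [gV VP]]; apply/IT_algebraP; exists V; split=> //.
move=> X M gX gM; elim: (n' - n)%N X gX => [|j IH] X gX.
  by move=> /VP rM; apply: (resolved_le (k := m.+1)) (rM gX gM).
move=> [X1 [P [[_ gP] [i [g [iI _ _]]] sM]]].
exact: IH (noethL _ _ _ iI gP) sM.
Qed.

End Bridge.

(** * The functor X |-> Xe *)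

Section Transport.
Variables (R R' : pzRingType) (F : lmodType R -> lmodType R').
Hypotheses (F_in_add : forall V M, in_add V M -> in_add (F V) (F M))
  (F_short_exact : forall A B C, short_exact A B C -> short_exact (F A) (F B) (F C))
  (F_zero : forall M, zero_module M -> zero_module (F M)).

(** F is given on objects only. An isomorphism is read as a short exact sequence with zero kernel,
    so preserving exactness is enough and no action on maps is required. *)
Lemma transport_isomorphic M N : isomorphic M N -> isomorphic (F M) (F N).
Proof.
move=> MN; apply: (@short_exact_zerol _ (F (free_module R 0))); first exact/F_zero/zero_free.
apply: F_short_exact; apply: short_exact_iso (short_exact_idl M (@zero_free R)) => //.
  exact: isomorphic_refl.
exact: isomorphic_refl.
Qed.

Lemma transport_resolved V k M : resolved V k M -> resolved (F V) k (F M).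
Proof.
elim: k M => [|k IH] M /=; first exact: F_zero.
move=> [V0 [K [addV0 sK rK]]]; exists (F V0), (F K); split; [exact: F_in_add | exact: F_short_exact | exact: IH].
Qed.

Hypothesis F_projective : forall P, fg_projective P -> fg_projective (F P).

Lemma transport_syzygy_of t X M : syzygy_of t X M -> syzygy_of t (F X) (F M).
Proof.
elim: t X => [|t IH] X /=; first exact: transport_isomorphic.
move=> [X1 [P [pP sX sM]]]; exists (F X1), (F P); split; [exact: F_projective | exact: F_short_exact | exact: IH].
Qed.

End Transport.

Section InAddProjective.
Variable R : pzRingType.

Lemma in_add_fg_projective (P : lmodType R) : in_add (reg_module R) P -> fg_projective P.
Proof.
move=> addP; split; last exact: in_add_fin_gen (fin_gen_reg R) addP.
have [n [W PW]] := addP => M N g f sg.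
have pPW : projective (P * W)%type := projective_iso (isomorphic_sym PW) (@projective_free R n).
have [h hP] := pPW _ _ g (f \o fst_map P W) sg.
by exists (h \o pair_map (idmap P) (zero_map P W)) => x /=; rewrite hP.
Qed.

End InAddProjective.

Section CornerModule.
Variables (L : pzRingType) (e : L) (idem_e : e * e = e).
Local Notation A := (corner idem_e).

Section Object.
Variable M : rmodType L.

Definition corner_module_pred (_ : e * e = e) : {pred M} := fun x => (e : L^c) *: x == x.
Definition corner_module := {x : M | x \in corner_module_pred idem_e}.
Local Notation T := corner_module.

HB.instance Definition _ := [isSub for (@sval M _ : T -> M)].
HB.instance Definition _ := [Choice of T by <:].

Fact corner_module_zmod_closed : zmod_closed (corner_module_pred idem_e).
Proof.
split=> [|x y]; rewrite !unfold_in; first by rewrite scaler0.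
by move=> /eqP ex /eqP ey; rewrite scalerBr ex ey.
Qed.
HB.instance Definition _ :=
  GRing.isZmodClosed.Build M (corner_module_pred idem_e) corner_module_zmod_closed.
HB.instance Definition _ := [SubChoice_isSubZmodule of T by <:].

Lemma corner_moduleP (x : T) : (e : L^c) *: val x = val x.
Proof. by apply/eqP; apply: (valP x). Qed.

Fact corner_module_scale_subproof (a : A^c) (x : T) :
  ((val (a : A) : L) : L^c) *: val x \in corner_module_pred idem_e.
Proof.
rewrite unfold_in scalerA; apply/eqP; congr (_ *: _).
exact: (corner_muler (a : A)).
Qed.
Definition corner_module_scale (a : A^c) (x : T) : T :=
  Sub (((val (a : A) : L) : L^c) *: val x) (corner_module_scale_subproof a x).

Fact corner_module_scaleA a b x :
  corner_module_scale a (corner_module_scale b x) = corner_module_scale (a * b) x.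
Proof. by apply: val_inj; rewrite /= scalerA. Qed.
Fact corner_module_scale1 : left_id 1 corner_module_scale.
Proof. by move=> x; apply: val_inj; exact: corner_moduleP. Qed.
Fact corner_module_scaleDr : right_distributive corner_module_scale +%R.
Proof. by move=> a x y; apply: val_inj; rewrite /= scalerDr. Qed.
Fact corner_module_scaleDl x : {morph corner_module_scale^~ x : a b / a + b}.
Proof. by move=> a b; apply: val_inj; rewrite /= scalerDl. Qed.
HB.instance Definition _ := GRing.Zmodule_isLmodule.Build A^c T
  corner_module_scaleA corner_module_scale1 corner_module_scaleDr corner_module_scaleDl.

Lemma val_corner_scale (a : A) (x : T) : val ((a : A^c) *: x) = ((val a : L) : L^c) *: val x.
Proof. by []. Qed.

Lemma corner_elt_subproof (x : M) : (e : L^c) *: x \in corner_module_pred idem_e.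
Proof. by rewrite unfold_in scalerA; apply/eqP; congr (_ *: _). Qed.
Definition corner_elt (x : M) : T := Sub ((e : L^c) *: x) (corner_elt_subproof x).

Lemma val_corner_elt x : val (corner_elt x) = (e : L^c) *: x.
Proof. by []. Qed.

End Object.

Local Notation S := (fun M : rmodType L => (corner_module M : rmodType A)).

Section Map.
Variables (M N : rmodType L) (f : {linear M -> N}).

Fact corner_map_subproof (x : corner_module M) : f (val x) \in @corner_module_pred N idem_e.
Proof. by rewrite unfold_in -linearZ /= corner_moduleP. Qed.

Definition corner_fun (x : corner_module M) : corner_module N :=
  Sub (f (val x)) (corner_map_subproof x).

Definition corner_map : {linear corner_module M -> corner_module N}.
Proof.
apply: (@linear_of A^c _ _ corner_fun) => [x y|a x]; apply: val_inj.
  by rewrite /= linearD.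
by rewrite /= linearZ.
Defined.

Lemma val_corner_map x : val (corner_map x) = f (val x).
Proof. by []. Qed.
End Map.

Lemma corner_short_exact M N P : short_exact M N P -> short_exact (S M) (S N) (S P).
Proof.
move=> [f [g [fI sg fg]]]; exists (corner_map f), (corner_map g); split.
- by move=> x y /(congr1 val)/fI/val_inj.
- move=> y; have [x gx] := sg (val y); exists (corner_elt x); apply: val_inj.
  by rewrite val_corner_map val_corner_elt linearZ /= gx corner_moduleP.
- move=> y; split=> [/(congr1 val)/fg[x fx]|[x <-]]; last by apply/val_inj/fg; exists (val x).
  exists (corner_elt x); apply: val_inj.
  by rewrite val_corner_map val_corner_elt linearZ /= fx corner_moduleP.
Qed.

Lemma corner_in_add V M : in_add V M -> in_add (S V) (S M).
Proof.
move=> /in_addP[s sP]; apply/in_addP.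
exists [seq (corner_map p.1, corner_map p.2) | p : {linear M -> V} * {linear V -> M} <- s].
move=> x; apply: val_inj; rewrite [LHS]sP big_map.
by rewrite (big_morph val (fun _ _ => erefl) erefl).
Qed.

Lemma corner_zero M : zero_module M -> zero_module (S M).
Proof. by move=> M0 x; apply/val_inj/M0. Qed.

Lemma corner_resolved V k M : resolved V k M -> resolved (S V) k (S M).
Proof. exact: (transport_resolved corner_in_add corner_short_exact corner_zero). Qed.

End CornerModule.

(** * The functor - (x) eL over eLe *)

Lemma dual_basis (R : pzRingType) (P : lmodType R) : fg_projective P ->
  exists (n : nat) (u : 'I_n -> P) (phi : 'I_n -> {linear P -> R^o}),
    forall x, x = \sum_(i < n) (phi i x : R) *: u i.
Proof.
move=> [pP /free_cover[n [g sg]]].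
have [h hP] := pP _ _ g (idmap P) sg.
have hD i : {morph (fun x => h x i) : x y / x + y} by move=> x y; rewrite linearD ffunE.
have hZ i a x : h (a *: x) i = (a *: (h x i : R^o)) by rewrite linearZ ffunE.
exists n, (fun i => g (basis_vector R i)), (fun i => @linear_of R P R^o _ (hD i) (hZ i)).
move=> x /=; rewrite -[LHS](hP x) [h x in LHS]free_module_sum linear_sum.
by apply: eq_bigr => i _; rewrite linearZ.
Qed.

Section Tensor.
Variables (L : pzRingType) (e : L) (idem_e : e * e = e).
Local Notation A := (corner idem_e).
Local Notation eL := (eL_module idem_e).
Local Notation S := (fun M : rmodType L => (corner_module idem_e M : rmodType A)).
Variables (q : nat) (u : 'I_q -> eL) (phi : 'I_q -> {linear eL -> A^o}).
Hypothesis phi_u : forall y, y = \sum_(j < q) (phi j y : A) *: u j.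

Fact eL_mulr_subproof (y : eL) (a : L) : val y * a \in @eL_pred L e.
Proof. by rewrite unfold_in mulrA; have /eqP-> := valP y. Qed.
Definition eL_mulr (y : eL) (a : L) : eL := Sub (val y * a) (eL_mulr_subproof y a).

Lemma val_eL_mulr y a : val (eL_mulr y a) = val y * a.
Proof. by []. Qed.

Lemma eL_mulrZ (a : A) y b : eL_mulr (a *: y) b = a *: eL_mulr y b.
Proof. by apply: val_inj; rewrite /= mulrA. Qed.

Lemma eL_mulrA y a b : eL_mulr (eL_mulr y a) b = eL_mulr y (a * b).
Proof. by apply: val_inj; rewrite /= mulrA. Qed.

Lemma eL_mulr1 y : eL_mulr y 1 = y.
Proof. by apply: val_inj; rewrite /= mulr1. Qed.

Lemma eL_mulrDr y a b : eL_mulr y (a + b) = eL_mulr y a + eL_mulr y b.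
Proof. by apply: val_inj; rewrite /= mulrDr. Qed.

Lemma eL_mulr_suml (I : Type) (r : seq I) (F : I -> eL) a :
  eL_mulr (\sum_(i <- r) F i) a = \sum_(i <- r) eL_mulr (F i) a.
Proof.
apply: (big_morph (eL_mulr^~ a)); last by apply: val_inj; rewrite /= mul0r.
by move=> x y; apply: val_inj; rewrite /= mulrDl.
Qed.

Fact eL_unit_subproof : e \in @eL_pred L e.
Proof. by rewrite unfold_in idem_e. Qed.
Definition eL_unit : eL := Sub e eL_unit_subproof.

Fact corner_of_eL_subproof (y : eL) : val y * e \in @corner_pred L e.
Proof. by rewrite unfold_in; have /eqP ey := valP y; rewrite mulrA ey -mulrA idem_e. Qed.
Definition corner_of_eL (y : eL) : A := Sub (val y * e) (corner_of_eL_subproof y).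

Lemma corner_of_eL_unit y : corner_of_eL y *: eL_unit = eL_mulr y e.
Proof. by apply: val_inj; rewrite /= -mulrA idem_e. Qed.

Lemma val_phi_u y : val y = \sum_(j < q) val (phi j y : A) * val (u j).
Proof.
by rewrite {1}(phi_u y) (big_morph val (fun _ _ => erefl) erefl).
Qed.

(** The multiplicativity behind the tensor module: the matrices (phi_l (u_j b)) compose like the
    elements b of L, and b = 1 gives an idempotent matrix rather than the identity. *)
Lemma phi_expand y b l :
  (phi l (eL_mulr y b) : A) = \sum_(j < q) (phi j y : A) * (phi l (eL_mulr (u j) b) : A).
Proof.
rewrite {1}(phi_u y) eL_mulr_suml linear_sum; apply: eq_bigr => j _.
by rewrite eL_mulrZ linearZ.
Qed.

(* The module N (x)_{eLe} eL, where n (x) y is the vector (n . phi_j(y))_j; the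
   vectors of N^q so obtained are those fixed by the idempotent (phi_j(u_i)). *)
Section Object.
Variable N : rmodType A.
Implicit Types (v : {ffun 'I_q -> N}) (a b : L).

Definition tensor_scale v a : {ffun 'I_q -> N} :=
  [ffun l => \sum_(i < q) ((phi l (eL_mulr (u i) a) : A) : A^c) *: v i].

Definition tensor_pred (_ : forall y, y = \sum_(j < q) (phi j y : A) *: u j) :
    {pred {ffun 'I_q -> N}} :=
  fun v => tensor_scale v 1 == v.

Lemma tensor_scaleM v a b : tensor_scale (tensor_scale v a) b = tensor_scale v (a * b).
Proof.
apply/ffunP => l; rewrite !ffunE.
under eq_bigr do rewrite ffunE scaler_sumr.
rewrite exchange_big; apply: eq_bigr => i _ /=.
rewrite -eL_mulrA phi_expand scaler_suml; apply: eq_bigr => j _.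
by rewrite scalerA.
Qed.

Definition tensor_module := {v : {ffun 'I_q -> N} | v \in tensor_pred phi_u}.
Local Notation T := tensor_module.

HB.instance Definition _ := [isSub for (@sval {ffun 'I_q -> N} _ : T -> {ffun 'I_q -> N})].
HB.instance Definition _ := [Choice of T by <:].

Lemma tensor_scaleD v w a : tensor_scale (v + w) a = tensor_scale v a + tensor_scale w a.
Proof.
apply/ffunP => l; rewrite !ffunE -big_split; apply: eq_bigr => i _.
by rewrite ffunE scalerDr.
Qed.

Lemma tensor_scaleN v a : tensor_scale (- v) a = - tensor_scale v a.
Proof.
apply/ffunP => l; rewrite !ffunE -sumrN; apply: eq_bigr => i _.
by rewrite ffunE scalerN.
Qed.

Lemma tensor_scale0 a : tensor_scale 0 a = 0.
Proof. by apply/ffunP => l; rewrite !ffunE big1 // => i _; rewrite ffunE scaler0. Qed.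

Fact tensor_zmod_closed : zmod_closed (tensor_pred phi_u).
Proof.
split=> [|v w]; rewrite !unfold_in; first by rewrite tensor_scale0.
by move=> /eqP hv /eqP hw; rewrite tensor_scaleD tensor_scaleN hv hw.
Qed.
HB.instance Definition _ :=
  GRing.isZmodClosed.Build {ffun 'I_q -> N} (tensor_pred phi_u) tensor_zmod_closed.
HB.instance Definition _ := [SubChoice_isSubZmodule of T by <:].

Lemma tensorP (v : T) : tensor_scale (val v) 1 = val v.
Proof. by apply/eqP; apply: (valP v). Qed.

Fact tensor_act_subproof v a : tensor_scale v a \in tensor_pred phi_u.
Proof. by rewrite unfold_in tensor_scaleM mulr1. Qed.
Definition tensor_elt v a : T := Sub (tensor_scale v a) (tensor_act_subproof v a).

Definition tensor_act (a : L^c) (v : T) : T := tensor_elt (val v) a.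

Fact tensor_actA (a b : L^c) (v : T) : tensor_act a (tensor_act b v) = tensor_act (a * b) v.
Proof. by apply: val_inj; rewrite /= tensor_scaleM. Qed.
Fact tensor_act1 : left_id 1 tensor_act.
Proof. by move=> v; apply: val_inj; apply: tensorP. Qed.
Fact tensor_actDr : right_distributive tensor_act +%R.
Proof. by move=> a v w; apply: val_inj; rewrite /= tensor_scaleD. Qed.
Fact tensor_actDl (v : T) : {morph tensor_act^~ v : a b / a + b}.
Proof.
move=> a b; apply/val_inj/ffunP => l; rewrite /= !ffunE -big_split; apply: eq_bigr => i _.
by rewrite eL_mulrDr linearD scalerDl.
Qed.
HB.instance Definition _ := GRing.Zmodule_isLmodule.Build L^c T
  tensor_actA tensor_act1 tensor_actDr tensor_actDl.

Lemma val_tensor_scale (a : L) (v : T) : val ((a : L^c) *: v) = tensor_scale (val v) a.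
Proof. by []. Qed.

Fact tensor_pure_subproof (n : N) (y : eL) :
  [ffun l => ((phi l y : A) : A^c) *: n] \in tensor_pred phi_u.
Proof.
rewrite unfold_in; apply/eqP/ffunP => l; rewrite !ffunE.
rewrite -[in RHS](eL_mulr1 y) phi_expand scaler_suml; apply: eq_bigr => i _.
by rewrite ffunE scalerA.
Qed.
Definition tensor_pure n y : T :=
  Sub [ffun l => ((phi l y : A) : A^c) *: n] (tensor_pure_subproof n y).

Lemma tensor_pureE n y l : val (tensor_pure n y) l = ((phi l y : A) : A^c) *: n.
Proof. by rewrite /= ffunE. Qed.

Lemma tensor_pure_scale (a : L) n y : (a : L^c) *: tensor_pure n y = tensor_pure n (eL_mulr y a).
Proof.
apply/val_inj/ffunP => l; rewrite val_tensor_scale tensor_pureE ffunE phi_expand scaler_suml.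
by apply: eq_bigr => i _; rewrite tensor_pureE scalerA.
Qed.

Lemma tensor_pureZ (a : A) n y : tensor_pure ((a : A^c) *: n) y = tensor_pure n (a *: y).
Proof. by apply/val_inj/ffunP => l; rewrite !tensor_pureE linearZ scalerA. Qed.

Lemma val_sum_tensor (I : Type) (r : seq I) (F : I -> T) l :
  val (\sum_(i <- r) F i) l = \sum_(i <- r) val (F i) l.
Proof.
rewrite (big_morph val (fun _ _ => erefl) erefl).
by rewrite sum_ffunE.
Qed.

Lemma tensor_sum_pure (v : T) : v = \sum_(j < q) tensor_pure (val v j) (u j).
Proof.
apply/val_inj/ffunP => l; rewrite val_sum_tensor -{1}tensorP ffunE.
by apply: eq_bigr => j _; rewrite tensor_pureE eL_mulr1.
Qed.

End Object.

Local Notation T := (fun N : rmodType A => (tensor_module N : rmodType L)).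

Section Map.
Variables (M N : rmodType A) (f : {linear M -> N}).

Lemma tensor_map_scale (v : {ffun 'I_q -> M}) a :
  [ffun l => f (tensor_scale v a l)] = tensor_scale [ffun l => f (v l)] a.
Proof.
apply/ffunP => l; rewrite !ffunE linear_sum; apply: eq_bigr => i _.
by rewrite linearZ ffunE.
Qed.

Fact tensor_map_subproof (v : tensor_module M) :
  [ffun l => f (val v l)] \in @tensor_pred N phi_u.
Proof. by rewrite unfold_in -tensor_map_scale tensorP. Qed.

Definition tensor_fun (v : tensor_module M) : tensor_module N :=
  Sub [ffun l => f (val v l)] (tensor_map_subproof v).

Definition tensor_map : {linear tensor_module M -> tensor_module N}.
Proof.
apply: (@linear_of L^c _ _ tensor_fun) => [v w|a v]; apply: val_inj.
  by apply/ffunP => l; rewrite /= !ffunE linearD.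
by rewrite /= tensor_map_scale.
Defined.

Lemma val_tensor_map v l : val (tensor_map v) l = f (val v l).
Proof. by rewrite /= ffunE. Qed.
End Map.

Lemma tensor_short_exact M N P : short_exact M N P -> short_exact (T M) (T N) (T P).
Proof.
move=> [f [g [fI sg fg]]]; exists (tensor_map f), (tensor_map g); split.
- move=> v w vw; apply/val_inj/ffunP => l; apply: fI.
  by rewrite -!val_tensor_map vw.
- move=> v; have /choice[w wP] l := sg (val v l).
  (* A coordinatewise lift need not be a fixed vector. Acting by 1 projects it onto the fixed
     vectors, and [g] commutes with that action. *)
  exists (tensor_elt [ffun l => w l] 1); apply: val_inj.
  rewrite /= tensor_map_scale -[RHS]tensorP; congr (tensor_scale _ _).
  by apply/ffunP => l; rewrite !ffunE wP.
- move=> v; split=> [gv0|[w <-]].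
    have /choice[w wP] l : exists x, f x = val v l.
      by apply/fg; rewrite -val_tensor_map gv0 ffunE.
    exists (tensor_elt [ffun l => w l] 1); apply: val_inj.
    rewrite /= tensor_map_scale -[RHS]tensorP; congr (tensor_scale _ _).
    by apply/ffunP => l; rewrite !ffunE wP.
  apply/val_inj/ffunP => l; rewrite !val_tensor_map ffunE.
  by apply/fg; exists (val w l).
Qed.

Lemma tensor_in_add V M : in_add V M -> in_add (T V) (T M).
Proof.
move=> /in_addP[s sP]; apply/in_addP.
exists [seq (tensor_map p.1, tensor_map p.2) | p : {linear M -> V} * {linear V -> M} <- s].
move=> v; apply/val_inj/ffunP => l; rewrite [LHS]sP big_map val_sum_tensor.
by apply: eq_bigr => p _; rewrite !val_tensor_map.
Qed.

Lemma tensor_zero M : zero_module M -> zero_module (T M).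
Proof. by move=> M0 v; apply/val_inj/ffunP => l; rewrite [LHS]M0 [RHS]M0. Qed.

Lemma tensor_resolved V k M : resolved V k M -> resolved (T V) k (T M).
Proof. exact: (transport_resolved tensor_in_add tensor_short_exact tensor_zero). Qed.

(** Under x (x) y |-> xy the module eLe (x) eL embeds in L with image eL, a direct summand. The
    retraction sends a to (1 (x) e) a. *)
Lemma tensor_regular : in_add (reg_module L^c) (T (reg_module A^c)).
Proof.
pose f (v : tensor_module (reg_module A^c)) : reg_module L^c :=
  \sum_(j < q) val (val v j : A) * val (u j).
have fD : {morph f : v w / v + w}.
  by move=> v w; rewrite /f -big_split; apply: eq_bigr => j _; rewrite ffunE /= mulrDl.
have fZ a v : f (a *: v) = a *: f v.
  rewrite [RHS](_ : _ = (f v : L) * (a : L)) // /f mulr_suml.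
  under eq_bigr => j _.
    rewrite val_tensor_scale ffunE (big_morph val (fun _ _ => erefl) erefl) mulr_suml.
  over.
  rewrite exchange_big; apply: eq_bigr => i _ /=.
  rewrite -mulrA -val_eL_mulr val_phi_u mulr_sumr; apply: eq_bigr => j _.
  by rewrite /= mulrA.
pose gl (a : reg_module L^c) : tensor_module (reg_module A^c) :=
  (a : L^c) *: tensor_pure (1 : reg_module A^c) eL_unit.
have gD : {morph gl : a b / a + b} by move=> a b; rewrite /gl scalerDl.
have gZ a b : gl (a *: b) = a *: gl b by rewrite /gl scalerA.
apply: (@in_add_retract _ _ _ _ (linear_of fD fZ) (linear_of gD gZ) _ (in_add_refl _)).
move=> v; rewrite /= /gl /f scaler_suml [RHS]tensor_sum_pure; apply: eq_bigr => j _.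
rewrite tensor_pure_scale.
have -> : eL_mulr eL_unit (val (val v j : A) * val (u j)) = (val v j : A) *: u j.
  by apply: val_inj; rewrite /= mulrA corner_mulel.
rewrite -tensor_pureZ; congr tensor_pure.
exact: (mul1r (val v j : A)).
Qed.

Lemma tensor_fg_projective P : fg_projective P -> fg_projective (T P).
Proof.
move=> /projective_in_add/tensor_in_add addP.
exact/in_add_fg_projective/(in_add_trans tensor_regular).
Qed.

Lemma tensor_fin_gen M : fin_gen M -> fin_gen (T M).
Proof.
move=> /projective_cover[K [P [/tensor_fg_projective[_ gP] /tensor_short_exact sM]]].
exact: short_exact_fin_gen sM gP.
Qed.

Lemma tensor_syzygy_of t X M : syzygy_of t X M -> syzygy_of t (T X) (T M).
Proof.
exact: (transport_syzygy_of tensor_short_exact tensor_zero tensor_fg_projective).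
Qed.

(** The map is n |-> n (x) e; since (n (x) y) e = n (ye) (x) e with ye in eLe, its inverse sends the
    vector v to the sum of the v_j (u_j e). *)
Lemma corner_tensor N : isomorphic N (S (T N)).
Proof.
have pure_in (n : N) : tensor_pure n eL_unit \in @corner_module_pred L e (tensor_module N) idem_e.
  rewrite unfold_in tensor_pure_scale; apply/eqP; congr tensor_pure.
  by apply: val_inj; rewrite /= idem_e.
pose f (n : N) : corner_module idem_e (tensor_module N) := Sub (tensor_pure n eL_unit) (pure_in n).
have fD : {morph f : x y / x + y}.
  by move=> x y; do 2!apply: val_inj; apply/ffunP => l; rewrite /= !ffunE scalerDr.
have fZ a x : f (a *: x) = a *: f x.
  apply: val_inj; rewrite val_corner_scale /= tensor_pure_scale.
  rewrite (tensor_pureZ (a : A)); congr tensor_pure; apply: val_inj.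
  by rewrite /= corner_muler corner_mulel.
exists (linear_of fD fZ).
exists (fun v : corner_module idem_e (tensor_module N) =>
    \sum_(j < q) (corner_of_eL (u j) : A^c) *: (val (val v : tensor_module N) : {ffun _ -> N}) j).
  move=> n /=; under eq_bigr do rewrite ffunE scalerA.
  rewrite -scaler_suml -[RHS]scale1r; congr (_ *: _).
  apply: val_inj; rewrite (big_morph val (fun _ _ => erefl) erefl) /=.
  under eq_bigr do rewrite mulrA.
  by rewrite -mulr_suml -val_phi_u /= idem_e.
move=> v; apply: val_inj; rewrite -[RHS]corner_moduleP; apply/val_inj/ffunP => l.
rewrite val_tensor_scale ffunE /= ffunE scaler_sumr; apply: eq_bigr => j _.
by rewrite scalerA -corner_of_eL_unit linearZ.
Qed.

Section Counit.
Variable X : rmodType L.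

Definition counit_fun (v : T (S X)) : X :=
  \sum_(j < q) (val (u j) : L^c) *: val (val v j).

Lemma val_sum_corner (I : Type) (r : seq I) (F : I -> corner_module idem_e X) :
  val (\sum_(i <- r) F i) = \sum_(i <- r) val (F i).
Proof. by rewrite (big_morph val (fun _ _ => erefl) erefl). Qed.

Definition counit : {linear T (S X) -> X}.
Proof.
apply: (@linear_of L^c _ _ counit_fun) => [v w|a v].
  by rewrite -big_split; apply: eq_bigr => j _; rewrite ffunE /= scalerDr.
rewrite /counit_fun scaler_sumr.
under eq_bigr => j _.
  rewrite val_tensor_scale ffunE val_sum_corner scaler_sumr.
over.
rewrite exchange_big; apply: eq_bigr => i _ /=.
rewrite scalerA -[_ * _]/(val (u i) * a) -val_eL_mulr val_phi_u scaler_suml.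
by apply: eq_bigr => j _; rewrite scalerA.
Defined.

Lemma counit_pure n y : counit (tensor_pure n y) = (val y : L^c) *: val n.
Proof.
rewrite [LHS]/(counit_fun _) /counit_fun val_phi_u scaler_suml; apply: eq_bigr => j _.
by rewrite tensor_pureE val_corner_scale scalerA.
Qed.

(** The element xe (x) e is mapped to xe, so e annihilates the cokernel. *)
Lemma counit_cokernel (x : X) : exists v, counit v = (e : L^c) *: x.
Proof.
exists (tensor_pure (corner_elt idem_e x) eL_unit).
by rewrite counit_pure val_corner_elt scalerA; congr (_ *: _).
Qed.

(** Since u_i a e lies in eLe, it comes out of phi_l (u_i a e b) as a factor in front of phi_l (e
    b). The l-th coordinate of v (a e b) is then (counit v) a e acted on by phi_l (e b), which
    vanishes. *)
Lemma counit_kernel (v : T (S X)) (a b : L) :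
  counit v = 0 -> (a * e * b : L^c) *: v = 0.
Proof.
move=> cv0; apply/val_inj/ffunP => l; rewrite val_tensor_scale !ffunE.
have eb_in : e * b \in @eL_pred L e by rewrite unfold_in mulrA idem_e.
pose eb : eL := Sub (e * b) eb_in.
have mE i : eL_mulr (u i) (a * e * b) = corner_of_eL (eL_mulr (u i) a) *: eb.
  by apply: val_inj; rewrite /= !mulrA -[_ * e * e]mulrA idem_e.
under eq_bigr do rewrite mE linearZ -scalerA.
rewrite -scaler_sumr; set w := \sum_i _; suff -> : w = 0 by rewrite scaler0.
apply: val_inj; rewrite val_sum_corner /=.
under eq_bigr do rewrite -mulrA -scalerA.
by rewrite -scaler_sumr [X in _ *: X](_ : _ = 0) ?scaler0.
Qed.

End Counit.

End Tensor.

(** * Finiteness over an Artin algebra *)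

Section RMorphismOf.
Variables (R S : pzRingType) (f : R -> S).
Hypotheses (fB : zmod_morphism f) (fM : monoid_morphism f).
Definition rmorphism_of : {rmorphism R -> S} :=
  HB.pack_for {rmorphism R -> S} f (GRing.isZmodMorphism.Build R S f fB)
    (GRing.isMonoidMorphism.Build R S f fM).
End RMorphismOf.

Lemma fin_gen_of_restriction (k R : pzRingType) (psi : {rmorphism k -> R}) (M : lmodType R) :
  fin_gen (restriction psi M : lmodType k) -> fin_gen M.
Proof.
move=> [n [g gP]]; exists n, g => x; have [c xE] := gP x.
by exists (fun i => psi (c i)); rewrite [LHS]xE.
Qed.

Section ArtinAlgebra.
Variables (L : pzRingType) (e : L) (idem_e : e * e = e).
Local Notation A := (corner idem_e).
Local Notation Q := (quotient_ring e).

Section Structure.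
Variables (k : comPzRingType) (phi : {rmorphism k -> L}).
Hypothesis (phiC : forall c x, phi c * x = x * phi c).

Fact converse_phi_monoid : monoid_morphism (phi : k -> L^c).
Proof. by split=> [|c d]; rewrite ?rmorph1 // mulrC rmorphM. Qed.
Definition converse_phi : {rmorphism k -> L^c} :=
  rmorphism_of (rmorphB phi : zmod_morphism (phi : k -> L^c)) converse_phi_monoid.

Definition quotient_phi : {rmorphism k -> Q^c} :=
  converse_rmorphism (@quotient_proj L e : {rmorphism L -> Q}) \o converse_phi.

Fact corner_phi_subproof c : phi c * e \in @corner_pred L e.
Proof. by rewrite unfold_in mulrA -phiC -!mulrA !idem_e. Qed.
Definition corner_phi_fun (c : k) : A := Sub (phi c * e) (corner_phi_subproof c).

Fact corner_phi_zmod : zmod_morphism corner_phi_fun.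
Proof. by move=> c d; apply: val_inj; rewrite /= rmorphB mulrBl. Qed.

Fact corner_phi_monoid : monoid_morphism corner_phi_fun.
Proof.
split=> [|c d]; apply: val_inj; rewrite /= ?rmorph1 ?mul1r //.
by rewrite rmorphM -[RHS]mulrA [e * _]mulrA -[e * phi d]phiC -[phi d * e * e]mulrA idem_e mulrA.
Qed.

Definition corner_phi : {rmorphism k -> A} := rmorphism_of corner_phi_zmod corner_phi_monoid.

Fact corner_phi_converse_monoid : monoid_morphism (corner_phi_fun : k -> A^c).
Proof.
split=> [|c d]; first exact: (rmorph1 corner_phi).
by rewrite mulrC; exact: (rmorphM corner_phi).
Qed.
Definition converse_corner_phi : {rmorphism k -> A^c} :=
  rmorphism_of (corner_phi_zmod : zmod_morphism (corner_phi_fun : k -> A^c))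
    corner_phi_converse_monoid.

Hypothesis fgL : fin_gen (left_restriction phi L^o : lmodType k).

(** The opposite ring, L/LeL, eLe and eL are all images of L under additive maps compatible with k,
    and inherit finite generation in this way. *)
Lemma fin_gen_push (M : lmodType k) (f : L -> M) :
  {morph f : x y / x + y} -> (forall c x, f (phi c * x) = c *: f x) ->
  surjective_map f -> fin_gen M.
Proof.
move=> fD fZ sf.
exact: (@fin_gen_surj k (restriction phi L^o) M
  (@linear_of k (restriction phi L^o) M f fD fZ) sf fgL).
Qed.

Lemma fin_gen_converse : fin_gen (restriction converse_phi (L^c)^o : lmodType k).
Proof.
apply: (@fin_gen_push (restriction converse_phi (L^c)^o) (id : L -> L)) => // y.
by exists y.
Qed.

Lemma fin_gen_quotient : fin_gen (restriction quotient_phi (Q^c)^o : lmodType k).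
Proof.
apply: (@fin_gen_push (restriction quotient_phi (Q^c)^o) (@quotient_proj L e : L -> Q)) => [x y|c x|y].
- exact: raddfD.
- by rewrite phiC; apply: quotient_projM.
- by elim/quotient_ind: y => y; exists y.
Qed.

Lemma fin_gen_corner : fin_gen (restriction converse_corner_phi (A^c)^o : lmodType k).
Proof.
have in_A x : e * x * e \in @corner_pred L e by rewrite unfold_in !mulrA idem_e -mulrA idem_e.
apply: (@fin_gen_push (restriction converse_corner_phi (A^c)^o)
  (fun x => Sub (e * x * e) (in_A x) : A)) => [x y|c x|y].
- by apply: val_inj; rewrite /= mulrDr mulrDl.
- apply: val_inj => /=; rewrite -[RHS]/(e * x * e * (phi c * e)).
  by rewrite (phiC c x) -!mulrA (phiC c e) !mulrA -(mulrA _ e e) idem_e.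
- by exists (val y); apply: val_inj; rewrite /= corner_mulel corner_muler.
Qed.

Lemma fin_gen_eL : fin_gen (eL_module idem_e : lmodType A).
Proof.
apply: (@fin_gen_of_restriction _ _ corner_phi).
have in_eL x : e * x \in @eL_pred L e by rewrite unfold_in mulrA idem_e.
apply: (@fin_gen_push (restriction corner_phi (eL_module idem_e))
  (fun x => Sub (e * x) (in_eL x) : eL_module idem_e)) => [x y|c x|y].
- by apply: val_inj; rewrite /= mulrDr.
- by apply: val_inj; rewrite /= mulrA -phiC -mulrA -[in RHS]mulrA (mulrA e e) idem_e.
- by exists (val y); apply: val_inj; apply/eqP/(valP y).
Qed.

Lemma corner_fin_gen_aux (M : rmodType L) :
  fin_gen M -> fin_gen (corner_module idem_e M : rmodType A).
Proof.
move=> /(fin_gen_restriction fin_gen_converse) gM.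
apply: (@fin_gen_of_restriction _ _ converse_corner_phi).
have fD : {morph (@corner_elt _ _ idem_e M) : x y / x + y}.
  by move=> x y; apply: val_inj; rewrite /= scalerDr.
have fZ (c : k) (x : restriction converse_phi M) :
    corner_elt idem_e (c *: x : M) =
    c *: (corner_elt idem_e (x : M) : restriction converse_corner_phi (corner_module idem_e M)).
  apply: val_inj; rewrite /= !scalerA.
  by congr (_ *: _); rewrite -[LHS]/(phi c * e) -[RHS]/(e * (phi c * e)) mulrA -phiC -mulrA idem_e.
have sf : surjective_map (@corner_elt _ _ idem_e M).
  by move=> y; exists (val y); apply: val_inj; apply: corner_moduleP.
exact: (@fin_gen_surj k (restriction converse_phi M)
  (restriction converse_corner_phi (corner_module idem_e M))
  (@linear_of k (restriction converse_phi M)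
    (restriction converse_corner_phi (corner_module idem_e M)) _ fD fZ) sf gM).
Qed.

End Structure.

Hypothesis artinL : artin_algebra L.

Lemma noetherian_algebra : noetherian L^c.
Proof.
have [k [phi [artk phiC fgL]]] := artinL.
exact: artin_algebra_noetherian artk (fin_gen_converse phiC fgL).
Qed.

Lemma noetherian_corner : noetherian A^c.
Proof.
have [k [phi [artk phiC fgL]]] := artinL.
exact: artin_algebra_noetherian artk (fin_gen_corner phiC fgL).
Qed.

Lemma noetherian_quotient : noetherian Q^c.
Proof.
have [k [phi [artk phiC fgL]]] := artinL.
exact: artin_algebra_noetherian artk (fin_gen_quotient phiC fgL).
Qed.

Lemma artinian_corner (M : rmodType A) : fin_gen M -> artinian M.
Proof.
have [k [phi [artk phiC fgL]]] := artinL.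
exact: (@artin_algebra_artinian _ _ _ artk (fin_gen_corner phiC fgL) M).
Qed.

Lemma artinian_quotient (M : rmodType Q) : fin_gen M -> artinian M.
Proof.
have [k [phi [artk phiC fgL]]] := artinL.
exact: (@artin_algebra_artinian _ _ _ artk (fin_gen_quotient phiC fgL) M).
Qed.

Lemma corner_fin_gen (M : rmodType L) :
  fin_gen M -> fin_gen (corner_module idem_e M : rmodType A).
Proof.
have [k [phi [artk phiC fgL]]] := artinL; exact: corner_fin_gen_aux phiC fgL M.
Qed.

Lemma dual_basis_eL : projective (eL_module idem_e : lmodType A) ->
  exists (q : nat) (u : 'I_q -> eL_module idem_e)
    (phi : 'I_q -> {linear eL_module idem_e -> A^o}),
    forall y, y = \sum_(j < q) (phi j y : A) *: u j.
Proof.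
have [k [phi [artk phiC fgL]]] := artinL.
by move=> pP; apply: dual_basis; split=> //; apply: fin_gen_eL phiC fgL.
Qed.

End ArtinAlgebra.

Section ImageFactorization.
Variables (R : pzRingType) (Y X : lmodType R) (f : {linear Y -> X}).

Lemma image_factorization :
  exists (K I C : lmodType R) (i : {linear K -> Y}) (p : {linear X -> C}),
    [/\ short_exact K Y I, short_exact I X C, injective i /\ (forall x, f (i x) = 0)
      & surjective_map p /\ forall y, p (f y) = 0].
Proof.
pose I := submodule_type (submodule_range f); pose j := submodule_val (submodule_range f).
have [C [p jp]] := short_exact_coker (@submodule_val_inj _ _ _ (submodule_range f)).
have idf : forall y, quotient_map (submodule_range f) (f y) = 0.
  by move=> y; apply/ker_quotient_map; exists y.
have jq : ses j (quotient_map (submodule_range f)).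
  split; [exact: submodule_val_inj | exact: quotient_map_surj |].
  move=> x; rewrite ker_quotient_map; split=> [|[z <-]]; last exact: submodule_valP.
  by move/(submodule_valK (submodule_range f)).
have [r rP] : exists r : {linear Y -> I}, forall y, j (r y) = f y by apply: (lift_kernel jq idf).
have sr : surjective_map r.
  move=> z; have [y _ yz] := submodule_valP z; exists y.
  by apply: (@submodule_val_inj _ _ _ (submodule_range f)); rewrite [LHS]rP.
have [K [i si]] := short_exact_ker sr; have [iI _ _] := si.
have [_ sp jpE] := jp.
exists K, I, C, i, p; split; [by exists i, r | by exists j, p | split=> // x | split=> // y].
  by rewrite -rP (ses_comp0 _ si) linear0.
by rewrite -rP (ses_comp0 _ jp).
Qed.

End ImageFactorization.

(** * Gluing along the counit *)

Section Transfer.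
Variables (L : pzRingType) (e : L) (idem_e : e * e = e).
Local Notation A := (corner idem_e).
Local Notation Q := (quotient_ring e).
Hypothesis artinL : artin_algebra L.
Hypothesis proj_eL : projective (eL_module idem_e : lmodType A).

Lemma IT_algebra_corner m n : IT_algebra L m n -> IT_algebra A m n.
Proof.
have [q [u [phi phi_u]]] := dual_basis_eL artinL proj_eL.
move=> /IT_algebraP[V [gV VP]]; apply/IT_algebraP.
exists (corner_module idem_e V); split; first exact: corner_fin_gen.
move=> X M gX gM /(tensor_syzygy_of phi_u) sM.
have := VP _ _ (tensor_fin_gen phi_u gX) (tensor_fin_gen phi_u gM) sM.
move=> /(corner_resolved idem_e); apply: resolved_iso.
exact/isomorphic_sym/corner_tensor.
Qed.

Definition annihilated (Z : rmodType L) := forall z : Z, (e : L^c) *: z = 0.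

Definition resolved_annihilated (U : rmodType L) m t :=
  forall Z : rmodType L, fin_gen Z -> annihilated Z -> resolved_syzygy_of U m.+1 t Z.

Section Upper.
Variables (q : nat) (u : 'I_q -> eL_module idem_e)
  (phi : 'I_q -> {linear eL_module idem_e -> A^o}).
Hypothesis phi_u : forall y, y = \sum_(j < q) (phi j y : A) *: u j.

Lemma tensor_corner_resolved n s t : (s <= t)%N -> IT_algebra A n s ->
  exists V : rmodType L, fin_gen V /\ forall X : rmodType L, fin_gen X ->
    resolved_syzygy_of V n.+1 t (tensor_module phi_u (corner_module idem_e X)).
Proof.
move=> st /(IT_algebra_leq (@noetherian_corner _ _ idem_e artinL) (leqnn n) st)/IT_algebraP.
move=> [V [gV VP]]; exists (tensor_module phi_u V); split; first exact: tensor_fin_gen.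
move=> X gX; have gSX := @corner_fin_gen _ _ idem_e artinL X gX.
have [M sM] := syzygy_of_exists (@noetherian_corner _ _ idem_e artinL) t gSX.
exists (tensor_module phi_u M); split; first exact: tensor_syzygy_of.
apply: tensor_resolved; apply: (VP _ _ gSX _ sM).
exact: (syzygy_of_fin_gen (@noetherian_corner _ _ idem_e artinL) gSX sM).
Qed.

Lemma counit_annihilated_kernel (X : rmodType L) (K : rmodType L)
    (i : {linear K -> tensor_module phi_u (corner_module idem_e X)}) :
  injective i -> (forall x, counit phi_u X (i x) = 0) -> annihilated K.
Proof.
move=> iI ci x; apply: iI; rewrite linear0 linearZ /=.
by have := counit_kernel 1 1 (ci x); rewrite mul1r mulr1.
Qed.

Lemma counit_annihilated_cokernel (X C : rmodType L) (p : {linear X -> C}) :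
  surjective_map p -> (forall y, p (counit phi_u X y) = 0) -> annihilated C.
Proof.
move=> sp pc z; have [x <-] := sp z; have [v cv] := counit_cokernel phi_u x.
by rewrite -linearZ -cv pc.
Qed.

(** A left linear section of L -> L/LeL sends 1 to some g with LeL g = 0 and 1 - g in LeL. Thus 1 -
    g is a right unit of LeL, which contains every u_i, and so it acts as the identity on the tensor
    module. But elements of LeL annihilate the kernel of the counit. *)
Lemma counit_injective (X : rmodType L) : projective (quotient_left e) ->
  injective (counit phi_u X).
Proof.
move=> pQ.
have [h hP] := pQ (L^o : lmodType L) (quotient_left e)
  (@linear_of L L^o (quotient_left e) (@quotient_proj L e) (raddfD _) (rmorphM _))
  (idmap _) (fun y => ex_intro _ _ (quotient_proj_repr y)).
pose g : L := h (@quotient_proj L e 1).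
have LeLg x : x \in LeL e -> x * g = 0.
  move=> xLeL; have : h (x *: (@quotient_proj L e 1 : quotient_left e)) = x * g by rewrite linearZ.
  suff -> : x *: (@quotient_proj L e 1 : quotient_left e) = 0 by rewrite linear0.
  rewrite [LHS](_ : _ = @quotient_proj L e (x * 1)); last by rewrite quotient_projM.
  by rewrite -(raddf0 (@quotient_proj L e)); apply/quotient_projP; rewrite mulr1 subr0.
have /LeLP[n [a [b fE]]] : 1 - g \in LeL e.
  by apply/quotient_projP/esym/(hP (@quotient_proj L e 1)).
apply: linear_injP => v cv.
have v1 : v = (1 - g : L^c) *: v.
  apply/val_inj/ffunP => l; rewrite val_tensor_scale -{1}tensorP !ffunE.
  apply: eq_bigr => i _; congr (_ *: _); congr (phi l _ : A); apply: val_inj => /=.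
  rewrite mulr1 mulrBr mulr1 LeLg ?subr0 //.
  have /eqP <- := valP (u i); apply: LeL_mulr; apply/LeLP.
  by exists 1, (fun=> 1), (fun=> 1); rewrite big_ord1 mul1r mulr1.
rewrite v1 fE scaler_suml big1 // => i _; exact: counit_kernel.
Qed.

Lemma IT_algebra_glue (U : rmodType L) m n s t : fin_gen U ->
  resolved_annihilated U m t -> (s <= t)%N -> IT_algebra A n s ->
  IT_algebra L (2 * m + n + 2) t.
Proof.
move=> gU UP st /(tensor_corner_resolved st)[V [gV VP]].
have noethL := noetherian_algebra artinL.
(* The image I gets (n+1) + (m+1) terms from T S X and K. Extending by the m+1 terms of C gives
   2m+n+3 terms. *)
have [W1 [gW1 W1P]] := resolved_syzygy_of_cokernel noethL n m.+1 gU gV.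
have [W2 [gW2 W2P]] := resolved_syzygy_of_extension noethL (n + m.+1).+1 m.+1 gU gW1.
apply/IT_algebraP; exists (W2 * reg_module L^c)%type; split.
  by apply: fin_gen_prod => //; apply: fin_gen_reg.
move=> X M gX gM sM; set Y := tensor_module phi_u (corner_module idem_e X).
have gY : fin_gen Y by apply/tensor_fin_gen/corner_fin_gen.
have [K [I [C [i [p [sI sC [iI ci] [sp pc]]]]]]] := image_factorization (counit phi_u X).
have rK := UP K (noethL _ _ i iI gY) (counit_annihilated_kernel iI ci).
have rC := UP C (fin_gen_surj sp gX) (counit_annihilated_cokernel sp pc).
have rI := W1P _ _ _ _ gY sI rK (VP X gX).
have := resolved_syzygy_of_stable (k := (n + m.+1 + m.+1)%N) (W2P _ _ _ _ sC rI rC) sM.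
by congr resolved; lia.
Qed.

Lemma IT_algebra_glue_injective (U : rmodType L) m n s t : fin_gen U ->
  projective (quotient_left e) ->
  resolved_annihilated U m t -> (s <= t)%N -> IT_algebra A n s ->
  IT_algebra L (m + n + 1) t.
Proof.
move=> gU pQ UP st /(tensor_corner_resolved st)[V [gV VP]].
have noethL := noetherian_algebra artinL.
(* With K = 0 the module X is itself an extension of C by T S X, which takes (n+1) + (m+1) terms. *)
have [W [gW WP]] := resolved_syzygy_of_extension noethL n.+1 m.+1 gU gV.
apply/IT_algebraP; exists (W * reg_module L^c)%type; split.
  by apply: fin_gen_prod => //; apply: fin_gen_reg.
move=> X M gX gM sM.
have [C [p cp]] := short_exact_coker (counit_injective (X := X) pQ).
have [_ sp _] := cp.
have rC := UP C (fin_gen_surj sp gX)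
  (counit_annihilated_cokernel sp (fun y => ses_comp0 y cp)).
have := resolved_syzygy_of_stable (k := (n + m.+1)%N) (WP _ _ _ _ (ex_intro _ _ (ex_intro _ _ cp)) (VP X gX) rC) sM.
by congr resolved; lia.
Qed.

End Upper.

(** * Modules annihilated by e, as modules over L/LeL *)

Section Descend.
Variable Z : rmodType L.
Hypothesis eZ : annihilated Z.

(** An alias of Z that carries the annihilation proof, on which the module structure over the
    quotient ring depends. *)
Definition descended (_ : annihilated Z) : Type := Z.
Local Notation D := (descended eZ).
HB.instance Definition _ := GRing.Zmodule.on D.

Lemma annihilated_LeL (x : L) (z : Z) : x \in LeL e -> (x : L^c) *: z = 0.
Proof.
move=> /LeLP[n [a [b ->]]]; rewrite scaler_suml big1 // => i _.
rewrite -[(_ * _ : L)]/((b i : L^c) * ((e : L^c) * (a i : L^c))) -!scalerA.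
by rewrite eZ scaler0.
Qed.

Definition descended_scale (x : Q^c) (z : D) : D :=
  (repr (x : {ideal_quot (LeL e)}) : L^c) *: (z : Z).

Lemma descended_scale_proj (x : L) (z : D) :
  descended_scale (@quotient_proj L e x) z = (x : L^c) *: (z : Z).
Proof.
apply/eqP; rewrite -subr_eq0 -scalerBl; apply/eqP; apply: annihilated_LeL.
by apply/quotient_projP; rewrite quotient_proj_repr.
Qed.

Fact descended_scaleA x y z :
  descended_scale x (descended_scale y z) = descended_scale (x * y) z.
Proof.
elim/quotient_ind: x => x; elim/quotient_ind: y => y.
rewrite -[_ * _]/(quotient_mul (@quotient_proj L e y) (@quotient_proj L e x)).
by rewrite -quotient_projM !descended_scale_proj scalerA.
Qed.
Fact descended_scale1 : left_id 1 descended_scale.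
Proof. by move=> z; rewrite -[1]/(@quotient_proj L e 1) descended_scale_proj scale1r. Qed.
Fact descended_scaleDr : right_distributive descended_scale +%R.
Proof. by move=> x y z; rewrite /descended_scale scalerDr. Qed.
Fact descended_scaleDl z : {morph descended_scale^~ z : x y / x + y}.
Proof.
elim/quotient_ind=> x; elim/quotient_ind=> y.
by rewrite -[_ + _](raddfD (@quotient_proj L e)) !descended_scale_proj scalerDl.
Qed.
HB.instance Definition _ := GRing.Zmodule_isLmodule.Build Q^c D
  descended_scaleA descended_scale1 descended_scaleDr descended_scaleDl.

Lemma descended_iso :
  isomorphic (right_restriction (@quotient_proj L e) (D : rmodType Q) : rmodType L) Z.
Proof.
have fZ (a : L^c) (x : right_restriction (@quotient_proj L e) (D : rmodType Q)) :
    (a *: x : Z) = a *: (x : Z) by apply: descended_scale_proj.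
exists (@linear_of L^c (right_restriction (@quotient_proj L e) (D : rmodType Q)) Z
  (fun x => x) (fun _ _ => erefl) fZ).
by exists (fun x => x).
Qed.

Lemma descended_fin_gen : fin_gen Z -> fin_gen (D : rmodType Q).
Proof.
move=> gZ; apply: (@fin_gen_of_restriction _ _ (converse_rmorphism (@quotient_proj L e))).
exact: fin_gen_iso (isomorphic_sym descended_iso) gZ.
Qed.

End Descend.

Local Notation res M := (right_restriction (@quotient_proj L e) M : rmodType L).

Definition restriction_map (M N : rmodType Q) (f : {linear M -> N}) : {linear res M -> res N}.
Proof.
apply: (@linear_of L^c (res M) (res N) f) => [x y|a x]; first exact: linearD.
exact: (linearZ_LR f (@quotient_proj L e a : Q^c) (x : M)).
Defined.

Lemma restriction_short_exact (M N P : rmodType Q) :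
  short_exact M N P -> short_exact (res M) (res N) (res P).
Proof. by move=> [f [g [fI sg fg]]]; exists (restriction_map f), (restriction_map g). Qed.

Lemma restriction_in_add (V M : rmodType Q) : in_add V M -> in_add (res V) (res M).
Proof.
move=> /in_addP[s sP]; apply/in_addP.
exists [seq (restriction_map p.1, restriction_map p.2) | p : {linear M -> V} * {linear V -> M} <- s].
by move=> x; rewrite big_map; apply: sP.
Qed.

Lemma restriction_zero (M : rmodType Q) : zero_module M -> zero_module (res M).
Proof. by move=> M0 x; apply: M0. Qed.

Lemma restriction_fin_gen (M : rmodType Q) : fin_gen M -> fin_gen (res M).
Proof.
move=> [n [g gP]]; exists n, g => x; have [c cP] := gP x.
exists (fun i => repr (c i : {ideal_quot (LeL e)})); rewrite [LHS]cP.
apply: eq_bigr => i _; rewrite -[RHS]/((@quotient_proj L e _ : Q^c) *: (g i : M)).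
by rewrite quotient_proj_repr.
Qed.

(** Right projectivity of L/LeL makes the restriction of its regular module projective over L, hence
    that of all of add. Syzygies over L/LeL thereby restrict to syzygies over L. *)
Lemma restriction_fg_projective : projective (quotient_right e) ->
  forall P : rmodType Q, fg_projective P -> fg_projective (res P).
Proof.
move=> pQ P /projective_in_add/restriction_in_add addP; apply: in_add_fg_projective.
apply: in_add_trans addP; apply: projective_in_add; split; first exact: pQ.
exact: restriction_fin_gen (fin_gen_reg Q^c).
Qed.

Lemma resolved_annihilated_projective m r t :
  projective (quotient_right e) -> IT_algebra Q m r -> (r <= t)%N ->
  exists U : rmodType L, fin_gen U /\ resolved_annihilated U m t.
Proof.
have noethQ := @noetherian_quotient _ e artinL.
move=> pQ ITQ rt; have /IT_algebraP[V [gV VP]] := IT_algebra_leq noethQ (leqnn m) rt ITQ.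
exists (res V); split; first exact: restriction_fin_gen.
move=> Z gZ eZ; have gD := descended_fin_gen eZ gZ.
have [M sM] := syzygy_of_exists noethQ t gD.
have rM := VP _ _ gD (syzygy_of_fin_gen noethQ gD sM) sM.
exists (res M); split.
  apply: syzygy_of_isol (descended_iso eZ) _.
  by apply: (transport_syzygy_of restriction_short_exact restriction_zero
    (restriction_fg_projective pQ)) sM.
exact: (transport_resolved restriction_in_add restriction_short_exact restriction_zero) rM.
Qed.

(** From t = d on, the t-th syzygy can be chosen projective, so a single term in add of the regular
    module resolves it. This is the case m = 0 of the gluing, with no condition on L/LeL as an
    algebra. *)
Lemma resolved_annihilated_finite_dim d t : (d <= t)%N ->
  (forall X : fgmod Q, exists n C, [/\ (n <= d)%N, resolution n C (res X)
     & forall i, projective (C i)]) ->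
  resolved_annihilated (reg_module L^c) 0 t.
Proof.
move=> dt pdX Z gZ eZ.
have [n [C [nd rC pC]]] := pdX (FGMod (descended_fin_gen eZ gZ)).
have [M [sM pM]] := projective_resolution_syzygy (leq_trans nd dt) rC pC.
exists M; split; first exact: syzygy_of_isol (descended_iso eZ) sM.
exact/resolved_in_add/projective_in_add.
Qed.

End Transfer.

(** * Syzygy-finite algebras and distances *)

Section Decomposition.
Variable R : pzRingType.
Implicit Types M N V W X : lmodType R.

Lemma direct_summand_trans X M N : direct_summand X M -> direct_summand M N -> direct_summand X N.
Proof.
move=> [U XU] [W MW]; exists (U * W)%type.
apply: isomorphic_trans (isomorphic_prodA _ _ _) _.
exact: isomorphic_trans (isomorphic_prod XU (isomorphic_refl W)) MW.
Qed.

Lemma direct_summand_iso X M : isomorphic X M -> direct_summand X M.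
Proof.
move=> XM; exists (free_module R 0); apply: isomorphic_trans (isomorphic_prodC _ _) _.
exact: isomorphic_trans (isomorphic_zerol _ (@zero_free R)) XM.
Qed.

Lemma direct_summand_fin_gen X M : direct_summand X M -> fin_gen M -> fin_gen X.
Proof.
move=> [W /isomorphic_sym/fin_gen_iso gXW] /gXW; apply: (@fin_gen_surj _ _ _ (fst_map X W)).
by move=> x; exists (x, 0).
Qed.

Lemma submodule_type_range M N (j : {linear N -> M}) :
  injective j -> isomorphic N (submodule_type (submodule_range j)).
Proof.
move=> jI; have [r rP] : exists r : {linear N -> submodule_type (submodule_range j)},
    forall x, submodule_val (submodule_range j) (r x) = j x.
  apply: (lift_kernel (g := quotient_map (submodule_range j))).
    split; [exact: submodule_val_inj | exact: quotient_map_surj |].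
    move=> x; rewrite ker_quotient_map; split=> [|[z <-]]; last exact: submodule_valP.
    by move/(submodule_valK (submodule_range j)).
  by move=> x; apply/ker_quotient_map; exists x.
have /choice[s sP] (z : submodule_type (submodule_range j)) :
    exists x, j x = submodule_val (submodule_range j) z.
  by have [x _ xz] := submodule_valP z; exists x.
exists r; exists s => [x|z]; first by apply: jI; rewrite sP rP.
by apply: (@submodule_val_inj _ _ _ (submodule_range j)); rewrite rP sP.
Qed.

(* A minimal direct summand of M outside add W would be a sum of two nonzero
   modules, one of them outside add W and properly contained in it. *)
Lemma artinian_in_add W M : artinian M ->
  (forall X, indecomposable X -> direct_summand X M -> in_add W X) -> in_add W M.
Proof.
move=> artM indW; apply: contrapT => notW.
pose F (S : set M) := exists subS : submodule S,
  direct_summand (submodule_type subS) M /\ ~ in_add W (submodule_type subS).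
have F_range N (j : {linear N -> M}) : injective j -> direct_summand N M -> ~ in_add W N ->
    F (range j).
  move=> /submodule_type_range Nj sN NW; exists (submodule_range j); split.
    exact: direct_summand_trans (direct_summand_iso (isomorphic_sym Nj)) sN.
  by move/(in_add_iso (isomorphic_sym Nj)).
have [S [[subS [sumS notS]] minS]] := artinian_minimal (F := F) artM
  (fun S FS => let: ex_intro subS _ := FS in subS)
  (ex_intro _ _ (F_range _ (idmap M) (fun _ _ => id) (direct_summand_iso (isomorphic_refl M)) notW)).
set X := submodule_type subS in sumS notS.
have nz (M1 M2 : lmodType R) : isomorphic X (M1 * M2)%type -> ~ in_add W M1 -> zero_module M2.
  move=> XM M1W m2; have /isomorphicP[f [g [fK gK]]] := XM.
  pose j : {linear M1 -> M} := submodule_val subS \o (g \o pair_map (idmap M1) (zero_map M1 M2)).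
  have jI : injective j by move=> x y /submodule_val_inj/(can_inj gK)[].
  have sum1 : direct_summand M1 M.
    apply: direct_summand_trans sumS; exists M2; exact: isomorphic_sym.
  (* The copy of M1 inside S is again a summand outside add W, so it fills S and leaves no room for
     M2. *)
  have jS : range j = S.
    by apply: minS; [apply: F_range | move=> _ [x _ <-]; apply: (submodule_valP (subS := subS))].
  have [m1 _] : range j (submodule_val subS (g (0, m2))) by rewrite jS; apply: submodule_valP.
  by move=> /submodule_val_inj/(can_inj gK)[_ <-].
apply: (notS); apply: indW => //; split.
  by move=> X0; apply: notS; apply: in_add_zero.
move=> M1 M2 XM; have [M1W|/(nz _ _ XM)] := pselect (in_add W M1); last by right.
have [M2W|/(nz _ _ (isomorphic_trans XM (isomorphic_prodC M1 M2)))] := pselect (in_add W M2);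
  last by left.
by case: notS; apply: in_add_iso (isomorphic_sym XM) (in_add_prod M1W M2W).
Qed.

End Decomposition.

Section SyzygyFinite.
Variable L : pzRingType.

Lemma common_add n (Y : 'I_n -> fgmod L) :
  exists W : rmodType L, fin_gen W /\ forall i, in_add W (Y i).
Proof.
elim: n Y => [|n IH] Y; first by exists (free_module L^c 0); split=> [|[]//]; apply: fin_gen_free.
have [W [gW WY]] := IH (fun i => Y (lift ord0 i)).
exists (W * Y ord0)%type; split; first by apply: fin_gen_prod => //; apply: fgmod_fin_gen.
move=> i; have [j ->|->] := unliftP ord0 i; last exact: in_add_snd.
exact: in_add_trans (in_add_fst _ _) (WY j).
Qed.

(** Take W to be a sum of the finitely many listed indecomposables. An n-th syzygy is artinian and
    its indecomposable summands lie in add W, hence so does the syzygy itself, which is then its own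
    resolution of length 0. *)
Lemma syzygy_finite_IT_algebra :
  (forall M : rmodType L, fin_gen M -> artinian M) ->
  syzygy_finite L -> exists n, IT_algebra L 0 n.
Proof.
move=> artM [n [N [Y YP]]]; exists n; apply/IT_algebraP.
have [W [gW WY]] := common_add Y; exists W; split=> // X M gX gM sM.
apply: resolved_in_add; apply: artinian_in_add (artM _ gM) _ => Z indZ sZ.
have [|i Zi] := YP (FGMod (direct_summand_fin_gen sZ gM)) indZ.
  exists (FGMod gM); split=> //; exists (FGMod gX); exact: syzygy_of_syzygy.
exact: in_add_iso (isomorphic_sym Zi) (WY i).
Qed.

End SyzygyFinite.

Import Order.TTheory Num.Theory.

(** * Infima and suprema of sets of natural numbers in the extended rationals *)

Section ExtendedRationals.
Implicit Types (S : set (\bar rat)) (P : nat -> Prop).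
Local Open Scope ereal_scope.

(** A set of rationals may have no least upper bound, in which case [ereal_sup] is a default value.
    Its value is known only once a supremum is exhibited. *)
Lemma ereal_sup_supremums S M : S !=set0 -> supremums S M -> ereal_sup S = M.
Proof.
move=> S0 SM; rewrite /ereal_sup /supremum ifF; last by apply/negbTE/set0P.
case: xgetP => [y -> Sy|noM]; last by case: (noM M).
exact: is_subset1_supremums Sy SM.
Qed.

Lemma ereal_inf_nat P :
  let inf := ereal_inf [set x : \bar rat | exists2 n, P n & x = n%:R%:E] in
  (exists m, [/\ P m, forall n, P n -> (m <= n)%N & inf = m%:R%:E]) \/
  ((forall n, ~ P n) /\ inf = +oo).
Proof.
move=> inf; have [exP|noP] := pselect (exists n, P n); last first.
  right; split; first by move=> n Pn; apply: noP; exists n.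
  rewrite /inf (_ : [set x | _] = set0) ?ereal_inf0 //.
  by apply/seteqP; split=> // x [n Pn]; case: noP; exists n.
have exb : exists n, `[< P n >] by have [n Pn] := exP; exists n; apply/asboolP.
left; case: (ex_minnP exb) => m /asboolP Pm mmin.
exists m; split=> // [n Pn|]; first by apply/mmin/asboolP.
rewrite /inf /ereal_inf (@ereal_sup_supremums _ (- m%:R%:E)) ?oppeK //.
  by exists (- m%:R%:E), m%:R%:E => //; exists m.
split=> [_ [_ [n Pn ->] <-]|y /= uy].
  by rewrite leeN2 lee_fin ler_nat; apply/mmin/asboolP.
by apply: uy; exists m%:R%:E => //; exists m.
Qed.

(** That [ereal_sup S] is below [+oo] does not by itself show that S has a supremum. The argument is
    by contraposition: when no natural number bounds S, the archimedean property leaves [+oo] as the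
    only upper bound, so it is the supremum. *)
Lemma ereal_sup_nat_bounded S :
  (forall x, S x -> x = +oo \/ exists n : nat, x = n%:R%:E) -> ereal_sup S < +oo ->
  exists d : nat, forall x, S x -> x <= d%:R%:E.
Proof.
move=> SN supS; apply: contrapT => /forallNP unb.
suff supE : ereal_sup S = +oo by rewrite supE ltxx in supS.
have Sbig (d : nat) : exists2 x, S x & d%:R%:E < x.
  apply: contrapT => nox; apply: (unb d) => x Sx; rewrite leNgt; apply/negP => dx.
  by apply: nox; exists x.
apply: ereal_sup_supremums; first by have [x Sx _] := Sbig 0%N; exists x.
split=> [x _|y uy]; first exact: leey.
have gt_all (d : nat) : d%:R%:E < y by have [x Sx dx] := Sbig d; apply: lt_le_trans dx (uy _ Sx).
case: y {uy} gt_all => [r| |] gt_all //; last by have := gt_all 0%N.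
have := gt_all (Num.bound `|r|%R); rewrite lte_fin ltNge ltW //.
exact: le_lt_trans (ler_norm r) (archi_boundP (normr_ge0 r)).
Qed.

Lemma IT_dist_le L m n : IT_algebra L m n -> IT_dist L <= m%:R%:E.
Proof.
move=> ITL; have [[k [_ kmin]]|[noL]] := ereal_inf_nat (fun m => exists n, IT_algebra L m n).
  by rewrite -/(IT_dist L) => ->; rewrite lee_fin ler_nat; apply: kmin; exists n.
by case: (noL m); exists n.
Qed.

Lemma IT_distP L :
  (exists m n, IT_algebra L m n /\ IT_dist L = m%:R%:E) \/ IT_dist L = +oo.
Proof.
have [[k [[n ITL] _ dE]]|[_ dE]] := ereal_inf_nat (fun m => exists n, IT_algebra L m n).
  by left; exists k, n.
by right.
Qed.

Lemma IT_dist_mono L L' :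
  (forall m n, IT_algebra L m n -> IT_algebra L' m n) -> IT_dist L' <= IT_dist L.
Proof.
move=> LL'; have [[m [n [/LL' ITL' ->]]]|->] := IT_distP L; first exact: IT_dist_le ITL'.
exact: leey.
Qed.

Lemma relative_gl_dim_bounded (L : pzRingType) (e : L) : relative_gl_dim e < +oo ->
  exists d, forall X : fgmod (quotient_ring e), exists n C,
    [/\ (n <= d)%N,
        resolution n C (right_restriction (@quotient_proj L e) X : rmodType L)
      & forall i, projective (C i)].
Proof.
pose rX X := right_restriction (@quotient_proj L e) X : rmodType L.
have pdE (X : fgmod (quotient_ring e)) :=
  ereal_inf_nat (fun n => exists C, resolution n C (rX X) /\ forall i, projective (C i)).
move=> /ereal_sup_nat_bounded[|d dP].
  move=> _ [X ->]; have [[m [_ _ pdm]]|[_ pdy]] := pdE X; last by left.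
  by right; exists m.
exists d => X; have : proj_dim (rX X) <= d%:R%:E by apply: dP; exists X.
have [[m [[C [rC pC]] _ pdm]]|[_ pdy]] := pdE X; last by rewrite [proj_dim _]pdy.
by rewrite [proj_dim _]pdm lee_fin ler_nat => md; exists m, C.
Qed.

End ExtendedRationals.

Theorem corollary1p3 (L : pzRingType) (artinL : artin_algebra L)
    (e : L) (idem_e : e * e = e)
    (proj_eL : projective (eL_module idem_e : lmodType (corner idem_e))) :
  [/\ (forall m n r s : nat,
        IT_algebra (quotient_ring e) m r -> IT_algebra (corner idem_e) n s ->
        projective (quotient_right e) ->
        IT_algebra L (2 * m + n + 2)%N (maxn r s)),
      (forall m n r s : nat,
        IT_algebra (quotient_ring e) m r -> IT_algebra (corner idem_e) n s ->
        projective (quotient_left e) -> projective (quotient_right e) ->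
        IT_algebra L (m + n + 1)%N (maxn r s)),
      (syzygy_finite (quotient_ring e) -> syzygy_finite (corner idem_e) ->
        projective (quotient_left e) -> projective (quotient_right e) ->
        Igusa_Todorov_algebra L),
      ((relative_gl_dim e < +oo)%E ->
        (IT_dist (corner idem_e) <= IT_dist L <= IT_dist (corner idem_e) + 2%:E)%E /\
        (projective (quotient_left e) ->
         (IT_dist (corner idem_e) <= IT_dist L <= IT_dist (corner idem_e) + 1%:E)%E))
    & (projective (quotient_right e) ->
        (IT_dist (corner idem_e) <= IT_dist L
           <= 2%:E * IT_dist (quotient_ring e) + IT_dist (corner idem_e) + 2%:E)%E /\
        (projective (quotient_left e) ->
         (IT_dist (corner idem_e) <= IT_dist L
            <= IT_dist (quotient_ring e) + IT_dist (corner idem_e) + 1%:E)%E))].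
Proof.
have [q [u [phi phi_u]]] := dual_basis_eL artinL proj_eL.
have [d1 d2] : (forall m n r s : nat,
    IT_algebra (quotient_ring e) m r -> IT_algebra (corner idem_e) n s ->
    projective (quotient_right e) -> IT_algebra L (2 * m + n + 2)%N (maxn r s)) /\
  (forall m n r s : nat,
    IT_algebra (quotient_ring e) m r -> IT_algebra (corner idem_e) n s ->
    projective (quotient_left e) -> projective (quotient_right e) ->
    IT_algebra L (m + n + 1)%N (maxn r s)).
  split=> m n r s ITQ ITA.
    move=> pR; have [U [gU UP]] := resolved_annihilated_projective artinL pR ITQ (leq_maxl r s).
    exact: (IT_algebra_glue artinL phi_u gU UP (leq_maxr r s) ITA).
  move=> pL pR; have [U [gU UP]] := resolved_annihilated_projective artinL pR ITQ (leq_maxl r s).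
  exact: (IT_algebra_glue_injective artinL phi_u gU pL UP (leq_maxr r s) ITA).
have lower : (IT_dist (corner idem_e) <= IT_dist L)%E.
  by apply: IT_dist_mono => m n; apply: IT_algebra_corner.
split=> //.
- move=> /(syzygy_finite_IT_algebra (@artinian_quotient _ e artinL))[r ITQ].
  move=> /(syzygy_finite_IT_algebra (@artinian_corner _ _ idem_e artinL))[s ITA] pL pR.
  (* Syzygy-finiteness gives m = n = 0, and m + n + 1 = 1 is the Igusa-Todorov case. *)
  by exists (maxn r s); apply: (d2 0%N 0%N).
- move=> /relative_gl_dim_bounded[d dP].
  (* The syzygy degree max(s, d) serves both the corner, which needs s, and the annihilated modules,
     which need d. *)
  have ann s := resolved_annihilated_finite_dim (leq_maxr s d) dP.
  rewrite !lower /=; have [[n [s [ITA dA]]]|dA] := IT_distP (corner idem_e); last by rewrite dA leey.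
  have regfg := fin_gen_reg L^c; rewrite dA -!EFinD; split=> [|pL].
    apply: le_trans (IT_dist_le (IT_algebra_glue artinL phi_u regfg (ann s) (leq_maxl s d) ITA)) _.
    by rewrite lee_fin muln0 add0n natrD.
  apply: le_trans (IT_dist_le
    (IT_algebra_glue_injective artinL phi_u regfg pL (ann s) (leq_maxl s d) ITA)) _.
  by rewrite lee_fin add0n natrD.
- move=> pR; rewrite !lower /=.
  (* When one of the two distances is infinite, so is the upper bound; otherwise both are attained
     and the bounds on algebras apply. *)
  have [[n [s [ITA dA]]]|dA] := IT_distP (corner idem_e); last first.
    rewrite dA; have [[m [r [_ ->]]]|->] := IT_distP (quotient_ring e).
      by rewrite -EFinM !addey // addye // leey; split.
    by rewrite gt0_muley ?lte_fin // !addye // leey; split.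
  have [[m [r [ITQ dQ]]]|dQ] := IT_distP (quotient_ring e); last first.
    by rewrite dQ dA gt0_muley ?lte_fin // !addye // leey; split.
  rewrite dA dQ -EFinM -!EFinD; split=> [|pL].
    apply: le_trans (IT_dist_le (d1 _ _ _ _ ITQ ITA pR)) _.
    by rewrite lee_fin 2!natrD natrM.
  apply: le_trans (IT_dist_le (d2 _ _ _ _ ITQ ITA pL pR)) _.
  by rewrite lee_fin !natrD.
Qed.
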